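(* There exists a universal constant $C>0$ such that the following holds. Let $n\ge 2$ and let $x^\ast \in \mathbb{R}^n$ be a $\Delta$-separated signal with $s>0$ jump discontinuities, where $\Delta \geq 8s/n$. Let $u>0$ and let $A \in \mathbb{R}^{m\times n}$ be a standard Gaussian random matrix (i.i.d. $\mathcal{N}(0,1)$ entries) with $$ m \geq C\left(\Delta^{-1}\, s\log^2(n) + u^2\right).$$ Then with probability at least $1-e^{-u^2/2}$, the vector $x^\ast$ is the unique solution of the total variation minimization problem $$\min_{x\in\mathbb{R}^n} \|\nabla x\|_1 \quad \text{subject to } y = Ax,$$ where $y = Ax^\ast \in \mathbb{R}^m$.
   Context: The discrete gradient operator $\nabla \in \mathbb{R}^{(n-1)\times n}$ is the forward-difference operator: $(\nabla x)_i = x_{i+1}-x_i$ for $i=1,\dots,n-1$. A signal $x^\ast\in\mathbb{R}^n$ has $s$ jump discontinuities if $\operatorname{supp}(\nabla x^\ast)=\{\nu_1,\dots,\nu_s\}$ with $0 =: \nu_0 < \nu_1<\dots<\nu_s<\nu_{s+1}:=n$. Such a signal is called $\Delta$-separated, for a separation constant $\Delta>0$, if $\min_{i\in\{1,\dots,s+1\}} \frac{|\nu_i-\nu_{i-1}|}{n} \geq \frac{\Delta}{s+1}$. *)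

(* Defs.v *)
From HB Require Import structures.
From mathcomp Require Import all_boot all_order all_algebra.
From mathcomp Require Import all_classical all_reals all_analysis.
From mathcomp Require Import Rstruct Rstruct_topology.
Set Implicit Arguments. Unset Strict Implicit. Unset Printing Implicit Defensive.
Import Order.TTheory GRing.Theory Num.Theory.
Local Open Scope classical_set_scope.
Local Open Scope ring_scope.

Section TV.
Variable R : realType.

(* Signals of length n are indexed by 'I_n.-1.+1 (= 'I_n when n >= 1),
   so that inord is available; (nabla x)_i = x_{i+1} - x_i. *)
Definition tv_norm (n : nat) (x : 'I_n.-1.+1 -> R) : R :=
  \sum_(0 <= i < n.-1) `| x (inord i.+1) - x (inord i) |.

(* supp(nabla x) in the paper's 1-based indexing: nu = i+1 such that
   x_{i+1} != x_i (0-based), i.e. the sorted list nu_1 < ... < nu_s. *)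
Definition jump_set (n : nat) (x : 'I_n.-1.+1 -> R) : seq nat :=
  [seq i.+1 | i <- iota 0 n.-1 & x (inord i.+1) != x (inord i)].

Definition delta_separated (n : nat) (Delta : R) (x : 'I_n.-1.+1 -> R) : Prop :=
  let J := jump_set x in
  let nu := 0%N :: J ++ [:: n] in
  forall k : nat, (k < (size J).+1)%N ->
    Delta / (size J).+1%:R <= `|(nth 0%N nu k.+1)%:R - (nth 0%N nu k)%:R| / n%:R.

Definition mulAx (m n : nat) (A : 'I_m -> 'I_n.-1.+1 -> R) (x : 'I_n.-1.+1 -> R)
  : 'I_m -> R := fun j => \sum_i A j i * x i.

Definition unique_tv_solution (m n : nat) (A : 'I_m -> 'I_n.-1.+1 -> R)
  (y : 'I_m -> R) (x : 'I_n.-1.+1 -> R) : Prop :=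
  mulAx A x = y /\
  forall z, mulAx A z = y -> z <> x -> tv_norm x < tv_norm z.

Definition iid_std_gaussian (d : measure_display) (T : measurableType d)
  (P : probability T R) (m n : nat) (A : 'I_m -> 'I_n.-1.+1 -> T -> R) : Prop :=
  (forall j i, measurable_fun setT (A j i)) /\
  forall B : 'I_m -> 'I_n.-1.+1 -> set R,
    (forall j i, measurable (B j i)) ->
    P (\bigcap_(k in [set: 'I_m * 'I_n.-1.+1]) (A k.1 k.2 @^-1` B k.1 k.2))
    = (\prod_(j < m) \prod_(i < n.-1.+1) normal_prob 0 1 (B j i))%E.
End TV.

(* Main.v *)
Require Import Defs.
From HB Require Import structures.
From mathcomp Require Import all_boot all_order all_algebra.
From mathcomp Require Import all_classical all_reals all_analysis.
From mathcomp Require Import Rstruct Rstruct_topology.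
From mathcomp Require Import measurable_realfun zify ring lra.
Set Implicit Arguments. Unset Strict Implicit. Unset Printing Implicit Defensive.
Import Order.TTheory GRing.Theory Num.Theory.
Local Open Scope classical_set_scope.
Local Open Scope ring_scope.

(** Let h = z - xs where Az = A xs and z has no larger total variation.  A dual
    weight equal to the sign of the jump at each jump and decaying like
    1 - sqrt (distance / lam) around it shows that the differences of h off the
    jumps, weighted by sqrt (min (distance, lam)), are summable with a bound
    O(sqrt (s ln n)) |h|.  Cut [0, n) at the multiples of lam and at dyadic
    distances from the jumps: h is then a combination of O(n) fixed vectors of
    norm at most 1 (normalised tails of blocks) with coefficients of l^1 norm
    rho <= sqrt kap |h|, where kap = O(s ln n / Delta).  By Maurey's empirical
    method, run for |x|^2 + |Ax|^2 / (4m) at once, h is close both in norm and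
    after applying A to rho / M times a signed sum of M = O(kap) of these
    vectors.  There are (2n)^M signed sums, so a union bound over chi-square
    tails gives |Av|^2 >= (m/6) |v|^2 for all of them as soon as m is of order
    M ln n + u^2, which is incompatible with Ah = 0 unless h = 0. *)

(** * Gaussian integrals *)

(** The obstacle is that [A] is controlled only on finitely many vectors fixed in advance, never on
    a whole cone of signals. Maurey's method therefore runs on the graph of [A]: an approximation of
    [h] then carries one of [Ah = 0], and only the images of the fixed vectors are needed. Their l^1
    cost has two sources. An increment inside a block costs the square root of the block length,
    which the weighted estimate pays for exactly when no block is longer than min(t, lam) at
    distance t from a jump. The value at the start of a block is averaged over the block, which
    costs by Cauchy-Schwarz the number of blocks. Dyadic distances and multiples of lam, with lam of
    order Delta n / s, reconcile the two: O(s ln n + s / Delta) blocks suffice. One factor ln n in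
    the number of measurements comes from [kap], hence from [M]; the other is the entropy ln(2n) of
    each choice in the union bound. Since independence is given as a product formula for rectangles,
    exponential moments are found by integrating out one entry of [A] at a time. *)

Section GaussianIntegral.
Variable R : realType.
Local Notation mu := (@lebesgue_measure R).

(** The change of variables produces the Radon-Nikodym derivative, which agrees almost everywhere
    with [normal_pdf] because both have the same integral over every measurable set. *)
Lemma ge0_integral_normal_prob (m s : R) (f : _ -> \bar R) :
  measurable_fun setT f -> (forall x, 0 <= f x)%E ->
  (\int[normal_prob m s]_x f x
   = \int[mu]_x (f x * (normal_pdf m s x)%:E))%E.
Proof.
move=> mf f0.
have dom := normal_prob_dominates m s.
rewrite -(Radon_Nikodym_SigmaFinite.change_of_variables dom)//.
apply: ae_eq_integral => //.
- apply: emeasurable_funM => //.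
  exact: measurable_int (Radon_Nikodym_SigmaFinite.f_integrable dom).
- apply: emeasurable_funM => //; apply/measurable_EFinP.
  exact: measurable_normal_pdf.
- apply: ae_eqe_mul2l; apply: integral_ae_eq => //.
  + exact: Radon_Nikodym_SigmaFinite.f_integrable.
  + by apply/measurable_EFinP; exact: measurable_normal_pdf.
  + by move=> E _ mE; rewrite -Radon_Nikodym_SigmaFinite.f_integral.
Qed.

(** Completing the square: with a = 1 - k v^2, the integrand times the standard density is a
    constant times the density of mean k v s / a and standard deviation a^(-1/2), whose integral is
    1. *)
Lemma gaussian_exp_square (k v s : R) : k * v ^+ 2 < 1 ->
  (\int[normal_prob 0 1]_x (expR (k * (s + v * x) ^+ 2 / 2))%:E
   = ((Num.sqrt (1 - k * v ^+ 2))^-1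
      * expR (k / (1 - k * v ^+ 2) * s ^+ 2 / 2))%:E)%E.
Proof.
move=> kv1; set a := 1 - k * v ^+ 2.
have a0 : 0 < a by rewrite subr_gt0.
have sa0 : 0 < Num.sqrt a by rewrite sqrtr_gt0.
rewrite ge0_integral_normal_prob; last 2 first.
- apply/measurable_EFinP; apply: measurableT_comp => //.
  apply: measurable_funM => //; apply: measurable_funM => //.
  by apply: measurable_funX; apply: measurable_funD => //; apply: measurable_funM.
- by move=> x; rewrite lee_fin expR_ge0.
rewrite -[RHS]mule1 -(integral_normal_pdf (k * v * s / a) (Num.sqrt a)^-1).
rewrite -ge0_integralZl; last 4 first.
- exact: measurableT.
- by apply/measurable_EFinP; exact: measurable_normal_pdf.
- by move=> x _; rewrite lee_fin normal_pdf_ge0.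
- by rewrite lee_fin mulr_ge0 ?expR_ge0// invr_ge0 ltW.
apply: eq_integral => x _; rewrite -!EFinM; congr EFin.
rewrite !normal_pdfE ?oner_neq0 ?invr_neq0 ?gt_eqF//.
rewrite /normal_peak /normal_fun expr1n mul1r exprVn sqr_sqrtr ?ltW//.
have sE : (Num.sqrt (a^-1 * pi *+ 2))^-1 = Num.sqrt a * (Num.sqrt (pi *+ 2))^-1.
  by rewrite -mulrnAr sqrtrM ?invr_ge0 ?ltW// sqrtrV ?ltW// invfM invrK.
rewrite sE; set c := (Num.sqrt (pi *+ 2))^-1. 
rewrite mulrCA -exp.expRD [RHS](_ : _ = c * (expR (k / a * s ^+ 2 / 2) *
   expR (- (x - k * v * s / a) ^+ 2 / (a^-1 *+ 2)))); last first.
  by field; rewrite gt_eqF.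
rewrite -exp.expRD; congr (_ * expR _).
have aN0 : a != 0 by rewrite gt_eqF.
move: aN0; rewrite /a => aN0.
field.
by rewrite aN0.
Qed.

End GaussianIntegral.

(** * Recursions driven by independent variables *)

Lemma finite_pushforward (R : realType) (d d' : measure_display)
  (T : measurableType d) (S : measurableType d')
  (Q : {finite_measure set T -> \bar R}) (f : T -> S) :
  measurable_fun setT f ->
  exists m : {finite_measure set S -> \bar R}, forall C, m C = Q (f @^-1` C).
Proof.
move=> mf; have fm : fin_num_fun (pushforward Q f).
  move=> U mU; rewrite /pushforward fin_num_measure//.
  by rewrite -[X in measurable X]setTI; exact: mf.
pose m : {finite_measure set S -> \bar R} :=
  HB.pack (pushforward Q f) (Measure_isFinite.Build _ _ _ _ fm).
by exists (m mf mf mf mf).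
Qed.

Lemma probability_pushforward (R : realType) (d d' : measure_display)
  (T : measurableType d) (S : measurableType d')
  (P : probability T R) (f : T -> S) :
  measurable_fun setT f ->
  exists rho : probability S R, forall C, rho C = P (f @^-1` C).
Proof.
move=> mf; have fT : pushforward P f setT = 1%E.
  by rewrite /pushforward preimage_setT probability_setT.
pose rho : probability S R :=
  HB.pack (pushforward P f) (Measure_isProbability.Build _ _ _ _ fT).
by exists (rho mf mf mf mf mf mf).
Qed.

Section Recursion.
Context (R : realType) (d ds de : measure_display) (T : measurableType d)
  (S : measurableType ds) (E : measurableType de) (nu : probability E R).
Variables (X : nat -> T -> E) (F : nat -> S * E -> S) (z0 : S).
Hypothesis mX : forall k, measurable_fun setT (X k).
Hypothesis mF : forall k, measurable_fun setT (F k).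

(** Relative to the mass of [Q], so that restricting [Q] to an event on the last
    variable again satisfies the condition, at the previous index. *)
Definition iid_upto (Q : set T -> \bar R) (k : nat) :=
  forall B : nat -> set E, (forall i, measurable (B i)) ->
    (Q (\bigcap_(i in `I_k) X i @^-1` B i) = Q setT * \prod_(i < k) nu (B i))%E.

Fixpoint state (k : nat) (w : T) : S :=
  if k is k'.+1 then F k' (state k' w, X k' w) else z0.

Lemma measurable_state k : measurable_fun setT (state k).
Proof.
elim: k => [|k IH] /=; first exact: measurable_cst.
by apply: measurableT_comp => //; apply: measurable_fun_pair.
Qed.

Lemma iid_uptoW Q k : iid_upto Q k.+1 -> iid_upto Q k.
Proof.
move=> H B mB.
have := H (fun i => if (i < k)%N then B i else setT).
rewrite big_ord_recr /= ltnn probability_setT mule1.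
rewrite (eq_bigr (fun i : 'I_k => nu (B i))) => [|i _]; last by rewrite ltn_ord.
move=> <-; last by move=> i; case: ifP.
  congr (Q _); apply/seteqP; split => w /= h i /= ik.
  case: ifP => // ik'; exact: h.
by have := h i (ltnW ik); rewrite ik.
Qed.

Lemma iid_upto_restr (Q : {finite_measure set T -> \bar R}) k B
  (mB : measurable (X k @^-1` B)) (Qoo : (Q (X k @^-1` B) < +oo)%E) :
  measurable B -> iid_upto Q k.+1 -> iid_upto (mfrestr mB Qoo) k.
Proof.
move=> mB' H C mC; rewrite /mfrestr /mrestr /= setTI.
have := H (fun i => if i == k then B else C i).
rewrite big_ord_recr /= eqxx => H1.
have E1 : \bigcap_(i in `I_k) X i @^-1` C i `&` X k @^-1` B =
  \bigcap_(i in `I_k.+1) X i @^-1` (if i == k then B else C i).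
  apply/seteqP; split => w /=.
    move=> [h hk] i /=; rewrite ltnS leq_eqVlt => /orP[/eqP ->|ik].
      by rewrite eqxx.
    by rewrite (ltn_eqF ik); exact: h.
  move=> h; split; last by have := h k (ltnSn k); rewrite eqxx.
  by move=> i /= ik; have := h i (ltnW ik); rewrite (ltn_eqF ik).
rewrite E1 H1; last by move=> i; case: ifP.
have := H (fun i => if i == k then B else setT).
rewrite big_ord_recr /= eqxx => H2.
have -> : (Q (X k @^-1` B) = Q setT * nu B)%E.
  rewrite (_ : X k @^-1` B = \bigcap_(i in `I_k.+1)
      X i @^-1` (if i == k then B else setT)).
    rewrite H2; last by move=> i; case: ifP.
    congr (_ * _)%E; rewrite big1 ?mul1e// => i _.
    by rewrite ltn_eqF// probability_setT.
  apply/seteqP; split => w /= h.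
    by move=> i /=; case: eqP => [->|].
  by have := h k (ltnSn k); rewrite /= eqxx.
rewrite -muleA; congr (_ * _)%E; rewrite muleC; congr (_ * _)%E.
by apply: eq_bigr => i _; rewrite ltn_eqF.
Qed.

(** The assumption [law] is applied to the restriction of [Q] to the event that [X k] lies in [B].
    As [rho] is the same for that restriction and for [Q], the event changes only the total mass, by
    the factor [nu B]. *)
Lemma state_law_indep (rho : probability S R) k
    (Q : {finite_measure set T -> \bar R}) :
  (forall Q' : {finite_measure set T -> \bar R}, iid_upto Q' k ->
     forall C, measurable C -> (Q' (state k @^-1` C) = Q' setT * rho C)%E) ->
  iid_upto Q k.+1 ->
  forall C B, measurable C -> measurable B ->
  (Q (state k @^-1` C `&` X k @^-1` B) = Q (state k @^-1` C) * nu B)%E.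
Proof.
move=> law iQ C B mC mB.
have mXB : measurable (X k @^-1` B) by rewrite -[X in measurable X]setTI; exact: mX.
have Qoo : (Q (X k @^-1` B) < +oo)%E.
  by rewrite ltey_eq fin_num_measure.
have -> : (Q (state k @^-1` C `&` X k @^-1` B)
    = Q (setT `&` X k @^-1` B) * rho C)%E.
  exact: law (mfrestr mXB Qoo) (iid_upto_restr mXB Qoo mB iQ) C mC.
rewrite setTI.
rewrite (law Q (iid_uptoW iQ) _ mC) muleAC; congr (_ * _)%E.
have := iQ (fun i => if i == k then B else setT).
rewrite big_ord_recr /= eqxx => H2.
rewrite (_ : X k @^-1` B = \bigcap_(i in `I_k.+1)
      X i @^-1` (if i == k then B else setT)).
  rewrite H2; last by move=> i; case: ifP.
  congr (_ * _)%E; rewrite big1 ?mul1e// => i _.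
  by rewrite ltn_eqF// probability_setT.
apply/seteqP; split => w /= h.
  by move=> i /=; case: eqP => [->|].
by have := h k (ltnSn k); rewrite /= eqxx.
Qed.


Lemma state_pair_law (Q : {finite_measure set T -> \bar R}) k :
  (forall C B, measurable C -> measurable B ->
  (Q (state k @^-1` C `&` X k @^-1` B) = Q (state k @^-1` C) * nu B)%E) ->
  exists2 m1 : {finite_measure set S -> \bar R},
   (forall C, m1 C = Q (state k @^-1` C)) &
   forall Y : set (S * E), measurable Y ->
     Q ((fun w => (state k w, X k w)) @^-1` Y) = (m1 \x nu)%E Y.
Proof.
move=> ind.
have ms := measurable_state k.
have [m1 m1E] := finite_pushforward Q ms.
exists m1 => // Y mY.
have mp : measurable_fun setT (fun w => (state k w, X k w)).
  exact: measurable_fun_pair.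
have -> : Q ((fun w => (state k w, X k w)) @^-1` Y) = pushforward Q (fun w => (state k w, X k w)) Y by [].
apply/esym; apply: product_measure_unique mY.
move=> A B mA mB; transitivity (Q (state k @^-1` A `&` X k @^-1` B)) => //.
by rewrite ind//; congr (_ * _)%E; rewrite -m1E.
Qed.

(** The order of quantifiers carries the induction: one [rho] serves every [Q], in particular the
    restrictions of a measure to events on the next variable, as [state_law_indep] demands. *)
Lemma state_law k : exists rho : probability S R,
  forall Q : {finite_measure set T -> \bar R}, iid_upto Q k ->
  forall C, measurable C -> (Q (state k @^-1` C) = Q setT * rho C)%E.
Proof.
elim: k => [|k [rho IH]].
  exists (dirac z0) => Q _ C mC /=; rewrite diracE.
  have [zC|zC] := boolP (z0 \in C).
    rewrite mule1; congr (Q _); apply/seteqP; split => // w _ /=.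
    by move: zC; rewrite inE.
  rewrite mule0 -[RHS](measure0 Q); congr (Q _); apply/seteqP; split => // w /=.
  by move: zC; rewrite notin_setE.
have [rho' rho'E] := probability_pushforward (rho \x nu)%E (mF k).
exists rho' => Q iQ C mC.
have [m1 m1E law] := state_pair_law (state_law_indep IH iQ).
have mFC : measurable (F k @^-1` C) by rewrite -[X in measurable X]setTI; exact: mF.
transitivity (Q ((fun w => (state k w, X k w)) @^-1` (F k @^-1` C))) => //.
rewrite law// rho'E /product_measure1 /=.
have QT0 : 0 <= fine (Q setT) by rewrite fine_ge0.
have mxs := measurable_fun_xsection nu mFC.
(* By the induction hypothesis [m1] is [rho] scaled by the mass of [Q], so the mass factors out of
   the integral. *)
transitivity (\int[mscale (NngNum QT0) rho]_x (nu \o xsection (F k @^-1` C)) x)%E.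
  apply: eq_measure_integral => A mA _.
  transitivity (Q (state k @^-1` A)); first exact: m1E.
  rewrite (IH Q (iid_uptoW iQ) A mA).
  transitivity ((fine (Q setT))%:E * rho A)%E => //.
  by rewrite fineK// fin_num_measure.
rewrite ge0_integral_mscale//=.
by congr (_ * _)%E; rewrite fineK// fin_num_measure.
Qed.

Lemma integral_state_step (Q : {finite_measure set T -> \bar R}) k
  (Psi : S -> \bar R) :
  iid_upto Q k.+1 -> measurable_fun setT Psi -> (forall z, 0 <= Psi z)%E ->
  (\int[Q]_w Psi (state k.+1 w)
   = \int[Q]_w \int[nu]_x Psi (F k (state k w, x)))%E.
Proof.
move=> iQ mPsi Psi0; have [rho law] := state_law k.
have [m1 m1E plaw] := state_pair_law (state_law_indep law iQ).
have ms := measurable_state k.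
have mp : measurable_fun setT (fun w => (state k w, X k w)).
  exact: measurable_fun_pair.
have mPF : measurable_fun setT (Psi \o F k) by exact: measurableT_comp.
transitivity (\int[pushforward Q (fun w => (state k w, X k w))]_z Psi (F k z))%E.
  by rewrite ge0_integral_pushforward.
transitivity (\int[m1 \x nu]_z Psi (F k z))%E.
  by apply: eq_measure_integral => A mA _; exact: plaw.
rewrite fubini_tonelli1//.
transitivity (\int[pushforward Q (state k)]_z fubini_F nu (Psi \o F k) z)%E.
  by apply: eq_measure_integral => A mA _; exact: m1E.
rewrite ge0_integral_pushforward//.
- by apply: measurable_fun_fubini_tonelli_F => //= z; exact: Psi0.
- by move=> z _; apply: integral_ge0 => y _; exact: Psi0.
Qed.

(** The last hypothesis says that [Phi k] evaluated at [state k] is a martingale, so its expectation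
    keeps the initial value. *)
Lemma integral_state (Q : {finite_measure set T -> \bar R}) N
  (Phi : nat -> S -> \bar R) :
  iid_upto Q N -> (forall k, measurable_fun setT (Phi k)) ->
  (forall k z, 0 <= Phi k z)%E ->
  (forall k z, (k < N)%N -> \int[nu]_x Phi k.+1 (F k (z, x)) = Phi k z)%E ->
  (\int[Q]_w Phi N (state N w) = Q setT * Phi 0%N z0)%E.
Proof.
move=> + mPhi Phi0; elim: N => [|N IH] iQ harm.
  by rewrite /= integral_cst// muleC.
rewrite integral_state_step// -IH; first last.
- by move=> k z kN; apply: harm; exact: ltnW.
- exact: iid_uptoW.
by apply: eq_integral => w _; rewrite harm.
Qed.

End Recursion.

(** * Exponential moments of |Av|^2 *)

Lemma big_ord_mul (T : Type) (idx : T) (op : Monoid.law idx) (m n : nat)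
  (F : nat -> T) :
  \big[op/idx]_(k < m * n) F k
  = \big[op/idx]_(j < m) \big[op/idx]_(i < n) F (j * n + i)%N.
Proof.
elim: m => [|m IH]; first by rewrite !big_ord0.
by rewrite big_ord_recr /= -IH mulSn addnC big_split_ord.
Qed.

Section GaussianMatrix.
Context (R : realType) (d : measure_display) (T : measurableType d)
  (P : probability T R).

(** Row-major enumeration of the matrix, with value 0 past the last row. *)
Definition matrix_entry (m n : nat) (A : 'I_m -> 'I_n.-1.+1 -> T -> R)
    (k : nat) (w : T) : R :=
  if insub (k %/ n.-1.+1)%N is Some j then A j (inord (k %% n.-1.+1)) w else 0.

Lemma matrix_entryE m n (A : 'I_m -> 'I_n.-1.+1 -> T -> R) (j : 'I_m)
  (i : 'I_n.-1.+1) : matrix_entry A (j * n.-1.+1 + i) = A j i.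
Proof.
apply/funext => w; rewrite /matrix_entry divnMDl// divn_small// addn0 valK.
by rewrite modnMDl modn_small// inord_val.
Qed.

Lemma measurable_matrix_entry m n (A : 'I_m -> 'I_n.-1.+1 -> T -> R) k :
  (forall j i, measurable_fun setT (A j i)) ->
  measurable_fun setT (matrix_entry A k).
Proof.
move=> mA; rewrite /matrix_entry; case: insub => [j|]; first exact: mA.
exact: measurable_cst.
Qed.

Lemma iid_upto_matrix_entry m n (A : 'I_m -> 'I_n.-1.+1 -> T -> R) :
  iid_std_gaussian P A ->
  iid_upto (normal_prob 0 1) (matrix_entry A) P (m * n.-1.+1).
Proof.
move=> [_ H] B mB.
rewrite probability_setT mul1e.
rewrite (@big_ord_mul _ _ _ _ _ (fun k => normal_prob 0 1 (B k))).
rewrite -(H (fun j i => B (j * n.-1.+1 + i)%N)); last by move=> j i; exact: mB.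
congr (P _); apply/seteqP; split => w /= h.
  move=> [j i] _ /=; rewrite -matrix_entryE; apply: h => /=.
  by rewrite -ltn_divLR// divnMDl// divn_small// addn0.
move=> k /= kN; have jm : (k %/ n.-1.+1 < m)%N by rewrite ltn_divLR.
have im : (k %% n.-1.+1 < n.-1.+1)%N by rewrite ltn_mod.
have := h (Ordinal jm, Ordinal im) Logic.I.
by rewrite /= -matrix_entryE /= -divn_eq.
Qed.

End GaussianMatrix.

Section ChiSquareMgf.
Context (R : realType) (d : measure_display) (T : measurableType d)
  (P : probability T R).
Variables (m n : nat) (X : nat -> T -> R) (v : nat -> R) (kappa : R).
Hypothesis mX : forall k, measurable_fun setT (X k).
Hypothesis n0 : (0 < n)%N.
Hypothesis iX : iid_upto (normal_prob 0 1) X P (m * n).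
Hypothesis kv1 : kappa * (\sum_(i < n) v i ^+ 2) < 1.

(** The state is the partial sum of the current row together with the sum of the
    squares of the completed rows. *)
Definition row_step (k : nat) (z : (R * R) * R) : R * R :=
  let s := z.1.1 + v (k %% n) * z.2 in
  if (k %% n).+1 == n then (0, z.1.2 + s ^+ 2) else (s, z.1.2).

Lemma measurable_row_step k : measurable_fun setT (row_step k).
Proof.
rewrite /row_step; set c := v _.
have ms : measurable_fun setT (fun z : (R * R) * R => z.1.1 + c * z.2).
  apply: measurable_funD; first by apply: measurableT_comp.
  exact: measurable_funM.
have mw : measurable_fun setT (fun z : (R * R) * R => z.1.2).
  by apply: measurableT_comp.
case: ((k %% n).+1 == n)%N; apply: measurable_fun_pair => //.
by apply: measurable_funD => //; exact: measurable_funX.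
Qed.

Lemma state_row_step j i : (i < n)%N ->
  forall w, state X row_step (0, 0) (j * n + i) w =
   (\sum_(l < i) v l * X (j * n + l)%N w,
    \sum_(l < j) (\sum_(l' < n) v l' * X (l * n + l')%N w) ^+ 2).
Proof.
have E (f : nat -> R) : \sum_(l < n) f l = \sum_(l < n.-1) f l + f n.-1.
  by move: n0; case: (n) => // n' _; rewrite big_ord_recr.
move=> + w; elim: j i => [|j IHj]; elim=> [|i IHi] lin.
- by rewrite !big_ord0.
- rewrite addnS /= IHi 1?ltnW// /row_step /= mul0n add0n modn_small 1?ltnW//.
  by rewrite ltn_eqF// big_ord_recr.
- rewrite addn0 mulSn addnC -(prednK n0) addnS /= prednK// IHj ?prednK//.
  rewrite /row_step /= modnMDl modn_small ?prednK// eqxx big_ord0.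
  congr (_, _); rewrite [RHS]big_ord_recr /=; congr (_ + _ ^+ 2).
  by rewrite (E (fun l => v l * X (j * n + l)%N w)).
- rewrite addnS /= IHi 1?ltnW// /row_step /= modnMDl modn_small 1?ltnW//.
  by rewrite ltn_eqF//; congr (_, _); rewrite [RHS]big_ord_recr.
Qed.

(** The variance still unread once [i] entries of the current row are known. It vanishes at the end
    of the row, where [a n = 1]. *)
Let tau i := \sum_(i <= l < n) v l ^+ 2.
Let a i := 1 - kappa * tau i.

Let a_gt0 i : 0 < a i.
Proof.
rewrite subr_gt0; have t0 : 0 <= tau i by apply: sumr_ge0 => l _; exact: sqr_ge0.
have [k0|k0] := leP 0 kappa; last first.
  by rewrite (le_lt_trans _ ltr01)// mulr_le0_ge0// ltW.
apply: le_lt_trans kv1; rewrite ler_wpM2l// -(big_mkord xpredT (fun l => v l ^+ 2)).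
have [ni|ni] := leqP n i.
  have -> : tau i = 0 by rewrite /tau big_geq.
  by rewrite big_mkord; apply: sumr_ge0 => l _; exact: sqr_ge0.
rewrite (big_cat_nat _ (n := i)) ?(ltnW ni)//= lerDr.
by apply: sumr_ge0 => l _; exact: sqr_ge0.
Qed.

(** Integrating out one entry turns [kappa / a i.+1] into [kappa / a i]: along
    [row_step] the functions [Phi k] below form a martingale. *)
Let phi i (z : R * R) : R :=
  (Num.sqrt (a i))^-1 * expR (kappa * z.2 / 2) * expR (kappa / a i * z.1 ^+ 2 / 2).

Let phi_step i s w : (i < n)%N ->
  (\int[normal_prob 0 1]_x (phi i.+1 (s + v i * x, w))%:E = (phi i (s, w))%:E)%E.
Proof.
move=> lin; have aE : a i = a i.+1 - kappa * v i ^+ 2.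
  by rewrite /a /tau (big_ltn lin) mulrDr opprD addrA addrAC.
have a1 := a_gt0 i.+1; have a2 := a_gt0 i.
have bE : 1 - kappa / a i.+1 * v i ^+ 2 = a i / a i.+1.
  by rewrite aE mulrBl divff ?gt_eqF// mulrAC.
under eq_integral do rewrite /phi /= EFinM.
rewrite ge0_integralZl//; last first.
- apply/measurable_EFinP; apply: measurableT_comp => //.
  apply: measurable_funM => //; apply: measurable_funM => //.
  by apply: measurable_funX; apply: measurable_funD => //; apply: measurable_funM.
rewrite gaussian_exp_square; last by rewrite -subr_gt0 bE divr_gt0.
rewrite bE -EFinM; congr EFin; rewrite /phi /= sqrtrM ?(ltW a2)// sqrtrV ?(ltW a1)//.
have s1 : 0 < Num.sqrt (a i.+1) by rewrite sqrtr_gt0.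
have s2 : 0 < Num.sqrt (a i) by rewrite sqrtr_gt0.
have -> : kappa / a i.+1 / (a i / a i.+1) = kappa / a i.
  by field; rewrite !gt_eqF.
by field; rewrite !gt_eqF.
Qed.

Let r := (Num.sqrt (1 - kappa * \sum_(i < n) v i ^+ 2))^-1.

Let a0E : a 0 = 1 - kappa * \sum_(i < n) v i ^+ 2.
Proof. by rewrite /a /tau big_mkord. Qed.

Let anE : a n = 1.
Proof. by rewrite /a /tau big_geq// mulr0 subr0. Qed.

(** Every unfinished row, the current one included, will contribute a factor [r]. The factor
    [Num.sqrt (a 0)] takes back the one of the current row, which [phi] accounts for entry by
    entry. *)
Let Phi k (z : R * R) : R :=
  r ^+ (m - k %/ n) * Num.sqrt (a 0) * phi (k %% n) z.

Let Phi_step k z : (k < m * n)%N ->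
  (\int[normal_prob 0 1]_x (Phi k.+1 (row_step k (z, x)))%:E = (Phi k z)%:E)%E.
Proof.
move=> kN; have km : (k %/ n < m)%N by rewrite ltn_divLR.
have kn : (k %% n < n)%N by rewrite ltn_mod.
case: z => s w; set i := (k %% n)%N.
have c0 : 0 <= r ^+ (m - k %/ n) * Num.sqrt (a 0).
  by rewrite mulr_ge0 ?sqrtr_ge0// exprn_ge0// invr_ge0 sqrtr_ge0.
transitivity ((r ^+ (m - k %/ n) * Num.sqrt (a 0))%:E *
   \int[normal_prob 0 1]_x (phi i.+1 (s + v i * x, w))%:E)%E; last first.
  by rewrite phi_step// -EFinM.
rewrite -ge0_integralZl//; last 2 first.
- apply/measurable_EFinP; rewrite /phi /=; apply: measurable_funM => //.
  apply: measurableT_comp => //.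
  apply: measurable_funM => //; apply: measurable_funM => //.
  by apply: measurable_funX; apply: measurable_funD => //; apply: measurable_funM.
- by move=> x _; rewrite lee_fin !mulr_ge0 ?expR_ge0// invr_ge0 sqrtr_ge0.
apply: eq_integral => x _; rewrite -EFinM; congr EFin.
rewrite /row_step /= -/i; case: ifPn => [/eqP iE|iN].
  (* At the end of a row [a n = 1], so the term in the row sum has become that of a finished row;
     resetting the sum to 0 costs the one factor [r] by which the exponent drops. *)
  have kE : k.+1 = ((k %/ n).+1 * n)%N.
    by rewrite mulSn {1}(divn_eq k n) -/i -addnS iE addnC.
  rewrite /Phi kE mulnK// modnMl subnS iE /phi /= anE a0E -/r.
  have r0 : Num.sqrt (1 - kappa * \sum_(i0 < n) v i0 ^+ 2) != 0.
    by rewrite gt_eqF// sqrtr_gt0 -a0E.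
  rewrite -[in RHS](@prednK (m - k %/ n)) ?subn_gt0//.
  rewrite sqrtr1 expr0n /= mulr0 mul0r exp.expR0 !divr1 invr1 mul1r.
  rewrite mulrDr mulrDl exp.expRD /r; move: r0; set q := Num.sqrt _ => r0.
  rewrite [_ ^+ _.-1.+1]exprS; set Y := _ ^+ _.-1; set Z := expR _ * expR _.
  by field.
have iN' : (i.+1 < n)%N by rewrite ltn_neqAle iN.
have kE : k.+1 = (k %/ n * n + i.+1)%N by rewrite addnS -divn_eq.
by rewrite /Phi kE divnMDl// (divn_small iN') addn0 modnMDl (modn_small iN').
Qed.

Lemma chi_square_mgf :
  (\int[P]_w (expR (kappa *
      (\sum_(j < m) (\sum_(i < n) v i * X (j * n + i)%N w) ^+ 2) / 2))%:E
   = (((Num.sqrt (1 - kappa * \sum_(i < n) v i ^+ 2))^-1) ^+ m)%:E)%E.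
Proof.
have mPhi k : measurable_fun setT (fun z => (Phi k z)%:E).
  apply/measurable_EFinP; rewrite /Phi /phi; apply: measurable_funM => //.
  apply: measurable_funM => //.
    apply: measurable_funM => //; apply: measurableT_comp => //.
    by apply: measurable_funM => //; apply: measurable_funM.
  apply: measurableT_comp => //; apply: measurable_funM => //.
  by apply: measurable_funM => //; exact: measurable_funX.
have Phi0 k z : (0 <= (Phi k z)%:E)%E.
  rewrite lee_fin !mulr_ge0 ?sqrtr_ge0 ?expR_ge0 ?invr_ge0 ?sqrtr_ge0//.
  by rewrite exprn_ge0// invr_ge0 sqrtr_ge0.
have s0 : Num.sqrt (a 0) != 0 by rewrite gt_eqF// sqrtr_gt0.
have hPhi (k : nat) (z : R * R) : (k < m * n)%N ->
  (\int[normal_prob 0 1]_x (Phi k.+1 (row_step k (z, x)))%:E = (Phi k z)%:E)%E.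
  exact: Phi_step.
have := @integral_state R _ _ _ T _ _ (normal_prob 0 1) X row_step (0, 0)
  mX measurable_row_step P (m * n) _ iX mPhi Phi0 hPhi.
rewrite [X in (X * _)%E](_ : _ = 1%E); last exact: probability_setT.
rewrite mul1e /Phi /phi /= div0n mod0n subn0 /= !mulr0 expr0n /=.
rewrite !(mulr0, mul0r) exp.expR0 !mulr1 -mulrA divff// mulr1 => <-.
apply: eq_integral => w _; congr EFin.
have := state_row_step m n0 w; rewrite addn0 => E0; rewrite [state _ _ _ _ _]E0.
rewrite mulnK// subnn expr0 mul1r modnMl /= big_ord0 expr0n /= mulr0 mul0r exp.expR0.
by rewrite mulr1 mulrA divff// mul1r.
Qed.

End ChiSquareMgf.

(** * Chernoff bounds for |Av|^2 *)

Definition sqnorm (R : realType) (n : nat) (x : 'I_n -> R) : R :=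
  \sum_i x i ^+ 2.

Lemma sqnorm_ge0 (R : realType) n (x : 'I_n -> R) : 0 <= sqnorm x.
Proof. by apply: sumr_ge0 => i _; exact: sqr_ge0. Qed.

Lemma measurable_set_lt (R : realType) (d : measure_display)
    (T : measurableType d) (f g : T -> R) :
  measurable_fun setT f -> measurable_fun setT g ->
  measurable [set w | f w < g w].
Proof.
move=> mf mg; rewrite -[X in measurable X]setTI.
rewrite [X in _ `&` X](_ : _ = (fun w => f w < g w) @^-1` [set true])//.
exact: measurable_fun_ltr.
Qed.

Lemma markov_exp (R : realType) (d : measure_display) (T : measurableType d)
    (P : probability T R) (f : T -> R) (a : R) : measurable_fun setT f ->
  (P [set w | (a <= f w)%R] <= (expR (- a))%:E * \int[P]_w (expR (f w))%:E)%E.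
Proof.
move=> mf; set S := [set w | _].
have mS : measurable S.
  by rewrite /S -[X in measurable X]setTI; apply: measurable_fun_le.
have mef : measurable_fun setT (fun w => (expR (f w))%:E).
  by apply/measurable_EFinP; exact: measurableT_comp.
rewrite -ge0_integralZl//.
rewrite -[X in P X]setIT -integral_indic//; apply: ge0_le_integral => //.
- by apply/measurable_EFinP; exact: measurable_indic.
- by apply/measurable_EFinP; apply: measurable_funM => //; exact/measurable_EFinP.
- move=> w _; rewrite lee_fin -exp.expRD indicE.
  have [wS|_] := boolP (w \in S); last exact: expR_ge0.
  by rewrite -[leLHS]exp.expR0 ler_expR addrC subr_ge0; move: wS; rewrite inE.
Qed.

Section GaussianTails.
Context (R : realType) (d : measure_display) (T : measurableType d)
  (P : probability T R).
Variables (m n : nat) (A : 'I_m -> 'I_n.-1.+1 -> T -> R).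
Hypothesis gA : iid_std_gaussian P A.

Local Notation image v w := (mulAx (fun j i => A j i w) v).

Lemma measurable_sqnorm_image (v : 'I_n.-1.+1 -> R) :
  measurable_fun setT (fun w => sqnorm (image v w)).
Proof.
apply: measurable_sum => j; apply: measurable_funX.
apply: measurable_sum => i; apply: measurable_funM => //.
by case: gA => + _; exact.
Qed.

Lemma sqnorm_image_mgf (v : 'I_n.-1.+1 -> R) (kappa : R) :
  kappa * sqnorm v < 1 ->
  (\int[P]_w (expR (kappa * sqnorm (image v w) / 2))%:E
   = (((Num.sqrt (1 - kappa * sqnorm v))^-1) ^+ m)%:E)%E.
Proof.
move=> kv; pose v' k := v (inord k).
have sE : sqnorm v = \sum_(i < n.-1.+1) v' i ^+ 2.
  by apply: eq_bigr => i _; rewrite /v' inord_val.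
have mX := fun k => measurable_matrix_entry (n := n) k gA.1.
rewrite sE in kv *.
rewrite -(chi_square_mgf mX (ltn0Sn _) (iid_upto_matrix_entry gA) kv).
apply: eq_integral => w _; congr EFin; congr expR; congr (_ * _); congr (_ * _).
apply: eq_bigr => j _; congr (_ ^+ 2); apply: eq_bigr => i _.
by rewrite matrix_entryE /v' inord_val mulrC.
Qed.

(** Chernoff with kappa = -3 / |v|^2: the moment is 4^(-m/2) = 2^(-m), at most e^(-m/2), while the
    threshold m/6 costs e^(m/4). For |v| = 0 the strict inequality makes the event empty. *)
Lemma sqnorm_image_lower_tail (v : 'I_n.-1.+1 -> R) :
  (P [set w | sqnorm (image v w) < m%:R / 6 * sqnorm v]%R
   <= (expR (- (m%:R / 4)))%:E)%E.
Proof.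
have [v0|v0] := eqVneq (sqnorm v) 0.
  rewrite [X in P X](_ : _ = set0) ?measure0 ?lee_fin ?expR_ge0//.
  apply/seteqP; split => // w /=; rewrite v0 mulr0 => /lt_geF.
  by rewrite sqnorm_ge0.
have vgt0 : 0 < sqnorm v by rewrite lt0r v0 sqnorm_ge0.
have kv : - 3 / sqnorm v * sqnorm v = - 3 by rewrite divfK.
apply: (@le_trans _ _ (P [set w |
    (- (m%:R / 4) <= - 3 / sqnorm v * sqnorm (image v w) / 2)%R])).
  apply: le_measure; rewrite ?inE.
  - by apply: measurable_set_lt => //; exact: measurable_sqnorm_image.
  - rewrite -[X in measurable X]setTI; apply: measurable_fun_le => //.
    apply: measurable_funM => //; apply: measurable_funM => //.
    exact: measurable_sqnorm_image.
  - move=> w /= h.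
    rewrite -ler_pdivrMr ?invr_gt0// invrK mulNr mulNr mulNr lerN2.
    rewrite -mulrAC ler_pdivrMr//.
    by rewrite -(ler_pM2r (x := 3%:R^-1)) ?invr_gt0//; lra.
apply: (le_trans (markov_exp _ _ _)).
  apply: measurable_funM => //; apply: measurable_funM => //.
  exact: measurable_sqnorm_image.
rewrite sqnorm_image_mgf; last by rewrite kv; lra.
rewrite kv [X in Num.sqrt X](_ : _ = 2 ^+ 2); last by ring.
rewrite sqrtr_sqr ger0_norm// -EFinM lee_fin opprK.
have half : (2^-1 : R) <= expR (- (1 / 2)).
  by apply: le_trans (expR_ge1Dx _); lra.
apply: (@le_trans _ _ (expR (m%:R / 4) * expR (- (1 / 2)) ^+ m)).
  by rewrite ler_pM2l ?expR_gt0// lerXn2r// nnegrE ?expR_ge0// invr_ge0.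
by rewrite -expRM_natl -exp.expRD ler_expR; lra.
Qed.

(** Chernoff with kappa = 3/4: as 1 - kappa |v|^2 is at least 1/4, the moment is at most 2^m, hence
    at most e^m, while the threshold 4m gains e^(-3m/2). *)
Lemma sqnorm_image_upper_tail (v : 'I_n.-1.+1 -> R) : sqnorm v <= 1 ->
  (P [set w | 4 * m%:R < sqnorm (image v w)]%R <= (expR (- (m%:R / 4)))%:E)%E.
Proof.
move=> v1.
have kv : 3 / 4 * sqnorm v < 1 by lra.
apply: (@le_trans _ _ (P [set w |
    (m%:R * 3 / 2 <= 3 / 4 * sqnorm (image v w) / 2)%R])).
  apply: le_measure; rewrite ?inE.
  - by apply: measurable_set_lt => //; exact: measurable_sqnorm_image.
  - rewrite -[X in measurable X]setTI; apply: measurable_fun_le => //.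
    apply: measurable_funM => //; apply: measurable_funM => //.
    exact: measurable_sqnorm_image.
  - by move=> w /= h; lra.
apply: (le_trans (markov_exp _ _ _)).
  apply: measurable_funM => //; apply: measurable_funM => //.
  exact: measurable_sqnorm_image.
rewrite sqnorm_image_mgf// -EFinM lee_fin.
have two : (2 : R) <= expR 1 by apply: le_trans (expR_ge1Dx _); lra.
have sq : (Num.sqrt (1 - 3 / 4 * sqnorm v))^-1 <= expR 1.
  apply: le_trans two; rewrite -[leRHS]invrK lef_pV2 ?posrE ?invr_gt0//.
    rewrite -[leLHS]ger0_norm ?invr_ge0// -sqrtr_sqr ler_sqrt; last lra.
    by rewrite exprVn; lra.
  by rewrite sqrtr_gt0; lra.
apply: (@le_trans _ _ (expR (- (m%:R * 3 / 2)) * expR 1 ^+ m)).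
  by rewrite ler_pM2l ?expR_gt0// lerXn2r// nnegrE ?expR_ge0// invr_ge0 sqrtr_ge0.
by rewrite -expRM_natl -exp.expRD ler_expR mulr1; have : (0 : R) <= m%:R by []; lra.
Qed.

End GaussianTails.

(** * Sparse approximation and recovery *)

Section Maurey.
Context (R : realType) (N : nat) (L : finType) (e : 'I_N -> L -> R) (c : 'I_N -> R).
Variable K : R.
Hypothesis eK : forall i, \sum_l e i l ^+ 2 <= K.

Let rho := \sum_i `|c i|.
Let h l := \sum_i c i * e i l.

Definition signed_sum (s : seq ('I_N * bool)) (l : L) : R :=
  \sum_(p <- s) (-1) ^+ p.2 * e p.1 l.

(** Averaging over [i] with weights [`|c i| / rho] cancels the cross term. *)
Lemma greedy_step (r : L -> R) : 0 < rho ->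
  exists p : 'I_N * bool,
    \sum_l (r l + h l - rho * ((-1) ^+ p.2 * e p.1 l)) ^+ 2
    <= \sum_l r l ^+ 2 + rho ^+ 2 * K.
Proof.
move=> rho0; pose s i := (c i < 0)%R.
pose phi i := \sum_l (r l + h l - rho * ((-1) ^+ s i * e i l)) ^+ 2.
suff [i phii] : exists i, phi i <= \sum_l r l ^+ 2 + rho ^+ 2 * K.
  by exists (i, s i).
apply: contrapT => /forallNP nphi.
have gtphi i : \sum_l r l ^+ 2 + rho ^+ 2 * K < phi i.
  by rewrite ltNge; apply/negP; exact: nphi.
have cs i : `|c i| * (-1) ^+ s i = c i.
  by rewrite /s mulrC mulr_sign_norm.
have avg : \sum_i `|c i| * phi i <= rho * (\sum_l r l ^+ 2 + rho ^+ 2 * K).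
  have -> : \sum_i `|c i| * phi i =
      \sum_l (rho * (r l + h l) ^+ 2 - 2 * rho * (r l + h l) * h l)
      + rho ^+ 2 * \sum_i `|c i| * \sum_l e i l ^+ 2.
    rewrite mulr_sumr.
    under [X in _ = _ + X]eq_bigr do rewrite mulr_sumr mulr_sumr.
    rewrite [X in _ = _ + X]exchange_big /= -big_split /=.
    under eq_bigr do rewrite /phi mulr_sumr.
    rewrite exchange_big /=; apply: eq_bigr => l _.
    rewrite /rho mulr_suml /h -/rho [in X in _ - X]mulr_sumr -sumrB -big_split /=.
    apply: eq_bigr => i _; rewrite -/(h l) -[in X in _ - X + _](cs i).
    have : ((-1) ^+ s i : R) ^+ 2 = 1 by rewrite sqrr_sign.
    set sg := (-1) ^+ s i => sg2.
    rewrite (_ : _ ^+ 2 = (r l + h l) ^+ 2 - 2 * rho * (r l + h l) * (sg * e i l)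
      + rho ^+ 2 * (sg ^+ 2 * e i l ^+ 2)); last by ring.
    by rewrite sg2; ring.
  rewrite mulrDr lerD//.
    (* Since (r + h)^2 - 2 (r + h) h = r^2 - h^2, the average falls short of the bound by rho
       h^2. *)
    rewrite [leRHS]mulr_sumr; apply: ler_sum => l _.
    rewrite -subr_ge0 (_ : _ - _ = rho * h l ^+ 2); last by ring.
    by rewrite mulr_ge0 ?sqr_ge0// ltW.
  rewrite mulrCA ler_wpM2l ?sqr_ge0// /rho mulr_suml.
  by apply: ler_sum => i _; rewrite ler_wpM2l.
have := avg; apply/negP; rewrite -ltNge /rho mulr_suml.
(* A positive weight is what makes the comparison of the averages strict. *)
have [i ci] : exists i, c i != 0.
  apply: contrapT => /forallNP c0; move: rho0; rewrite /rho big1 ?ltxx// => i _.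
  by have /negP := c0 i; rewrite negbK => /eqP ->; rewrite normr0.
apply: (@lt_le_trans _ _ (\sum_i0 `|c i0| * phi i0)) => //.
rewrite (bigD1 i)//= [ltRHS](bigD1 i)//=; apply: ltr_leD.
  by rewrite ltr_pM2l ?normr_gt0.
by apply: ler_sum => k _; rewrite ler_wpM2l// ltW.
Qed.

(** Greedy choices replace random sampling. Each one raises the squared residual by at most rho^2 K,
    so after division by M^2 the error is at most rho^2 K / M. *)
Lemma maurey M : 0 < rho ->
  exists s : M.-tuple ('I_N * bool),
    \sum_l (M%:R * h l - rho * signed_sum s l) ^+ 2 <= M%:R * (rho ^+ 2 * K).
Proof.
move=> rho0; elim: M => [|M [s IH]].
  exists [tuple]; rewrite mul0r big1// => l _.
  by rewrite /signed_sum big_nil mulr0 mul0r subrr expr0n.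
have [p hp] := greedy_step (fun l => M%:R * h l - rho * signed_sum s l) rho0.
exists (cons_tuple p s).
rewrite [leLHS](eq_bigr (fun l => (M%:R * h l - rho * signed_sum s l + h l
    - rho * ((-1) ^+ p.2 * e p.1 l)) ^+ 2)).
  by apply: (le_trans hp); rewrite -natr1 mulrDl mul1r lerD2r.
by move=> l _; rewrite /signed_sum /= big_cons -natr1; congr (_ ^+ 2); ring.
Qed.

End Maurey.

Section Recovery.
Context (R : realType) (m n N M : nat) (A : 'I_m -> 'I_n.-1.+1 -> R)
  (atom : 'I_N -> 'I_n.-1.+1 -> R) (c : 'I_N -> R) (kap : R).
Hypothesis m0 : (0 < m)%N.
Hypothesis atom1 : forall i, sqnorm (atom i) <= 1.
Hypothesis Aatom : forall i, sqnorm (mulAx A (atom i)) <= 4 * m%:R.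
Hypothesis Alow : forall s : M.-tuple ('I_N * bool),
  m%:R / 6 * sqnorm (signed_sum atom s) <= sqnorm (mulAx A (signed_sum atom s)).
Let h l := \sum_i c i * atom i l.
Hypothesis Ah : forall j, mulAx A h j = 0.
Hypothesis ck : (\sum_i `|c i|) ^+ 2 <= kap * sqnorm h.
Hypothesis kM : 128 * kap <= M%:R.

(** As [Ah = 0], the image half of the Maurey estimate bounds the image of the signed sum itself,
    and [Alow] turns this into smallness of the signed sum. The other half says that [h] is close to
    its multiple, hence too small unless it vanishes. *)
Lemma kernel_trivial : sqnorm h = 0.
Proof.
apply/eqP; rewrite -[_ == 0]negbK; apply/negP => hN0.
have h0 : 0 < sqnorm h by rewrite lt0r hN0 sqnorm_ge0.
pose rho := \sum_i `|c i|.
have ckr : rho ^+ 2 <= kap * sqnorm h by exact: ck.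
have mR : (0 : R) < m%:R by rewrite ltr0n.
have rho0 : 0 < rho.
  rewrite lt0r sumr_ge0// andbT; apply/negP => /eqP rho0; move: hN0.
  rewrite /sqnorm big1 ?eqxx// => l _; rewrite /h big1 ?expr0n// => i _.
  have /eqP := rho0; rewrite psumr_eq0// => /allP /(_ i).
  by rewrite mem_index_enum normr_eq0 => /(_ isT) /eqP ->; rewrite mul0r.
pose t : R := Num.sqrt (4 * m%:R)^-1.
have t2 : t ^+ 2 = (4 * m%:R)^-1 by rewrite sqr_sqrtr// invr_ge0 mulr_ge0.
(* The atoms are lifted to the graph of [A]; the scaling [t] makes either half contribute at most 1
   to the squared norm. *)
pose e (i : 'I_N) (l : 'I_n.-1.+1 + 'I_m) : R :=
  match l with inl l => atom i l | inr j => t * mulAx A (atom i) j end.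
have e2 i : \sum_l e i l ^+ 2 <= 2.
  rewrite big_sumType /= -[2]/(1 + 1 : R) lerD//; first exact: atom1.
  under eq_bigr do rewrite exprMn.
  rewrite -mulr_sumr t2 mulrC ler_pdivrMr ?mulr_gt0// mul1r; exact: Aatom.
have [s] := maurey e2 M rho0.
rewrite big_sumType /= -/rho.
set r := fun l => M%:R * h l - rho * signed_sum atom s l.
have -> : \sum_i (M%:R * (\sum_i0 c i0 * e i0 (inl i)) -
    rho * signed_sum e s (inl i)) ^+ 2 = sqnorm r by [].
have -> : \sum_i (M%:R * (\sum_i0 c i0 * e i0 (inr i)) -
    rho * signed_sum e s (inr i)) ^+ 2
    = (4 * m%:R)^-1 * (rho ^+ 2 * sqnorm (mulAx A (signed_sum atom s))).
  rewrite -t2 /sqnorm mulr_sumr mulr_sumr; apply: eq_bigr => j _.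
  have -> : \sum_i c i * e i (inr j) = t * mulAx A h j.
    rewrite /mulAx /h mulr_sumr; under eq_bigr do rewrite /= /mulAx mulr_sumr mulr_sumr.
    rewrite exchange_big /=; apply: eq_bigr => l _; rewrite mulr_sumr mulr_sumr.
    by apply: eq_bigr => i _; ring.
  have -> : signed_sum e s (inr j) = t * mulAx A (signed_sum atom s) j.
    rewrite /signed_sum /mulAx mulr_sumr.
    under eq_bigr do rewrite /= /mulAx mulr_sumr mulr_sumr.
    rewrite exchange_big /=; apply: eq_bigr => l _; rewrite mulr_sumr mulr_sumr.
    by apply: eq_bigr => i _; ring.
  by rewrite Ah; ring.
move=> hs; have := Alow s; set V := sqnorm (signed_sum atom s).
set W := sqnorm (mulAx A _) in hs * => VW.
have tri : M%:R ^+ 2 * sqnorm h <= 2 * sqnorm r + 2 * (rho ^+ 2 * V).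
  rewrite /V /sqnorm !mulr_sumr -big_split; apply: ler_sum => l _.
  rewrite /r -subr_ge0; set x := M%:R * h l; set y := rho * _.
  have -> : 2 * (x - y) ^+ 2 + 2 * (rho ^+ 2 * signed_sum atom s l ^+ 2)
     - M%:R ^+ 2 * h l ^+ 2 = (x - 2 * y) ^+ 2 by rewrite /x /y; ring.
  exact: sqr_ge0.
have V0 : rho ^+ 2 * V <= 24 * ((4 * m%:R)^-1 * (rho ^+ 2 * W)).
  have -> : 24 * ((4 * m%:R)^-1 * (rho ^+ 2 * W)) = rho ^+ 2 * (6 * W / m%:R).
    by field; rewrite gt_eqF.
  by rewrite ler_pM2l ?exprn_gt0// ler_pdivlMr//; lra.
have r0 : 0 <= sqnorm r by exact: sqnorm_ge0.
have M0 : (0 : R) < M%:R.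
  apply: lt_le_trans kM; rewrite mulr_gt0//.
  by rewrite -(pmulr_lgt0 _ h0); apply: lt_le_trans ckr; rewrite exprn_gt0.
(* The factor 128 enters here: with K = 2 it gives 1/64. The triangle inequality and [Alow] lose 2 *
   24 = 48, which stays below 64. *)
have key : M%:R * (rho ^+ 2 * 2) <= M%:R ^+ 2 * sqnorm h / 64.
  apply: (@le_trans _ _ (M%:R * (kap * sqnorm h * 2))).
    by rewrite ler_pM2l// ler_pM2r.
  rewrite (_ : M%:R ^+ 2 * sqnorm h / 64 = M%:R * (M%:R / 64 * sqnorm h)); last by field.
  rewrite ler_pM2l// mulrAC ler_pM2r//.
  by move: kM; lra.
have Mh : 0 < M%:R ^+ 2 * sqnorm h by rewrite mulr_gt0// exprn_gt0.
by lra.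
Qed.

End Recovery.

(** * Block expansions of a signal *)

Section Blocks.
Context (R : realType) (n : nat) (st : pred nat).
Hypothesis st0 : st 0.

Fixpoint last_start (j : nat) : nat :=
  if j is j'.+1 then if st j then j else last_start j' else 0%N.

Lemma last_start_le j : (last_start j <= j)%N.
Proof. by elim: j => //= j IH; case: ifP => // _; exact: leqW. Qed.

Lemma last_start_start j : st (last_start j).
Proof. by elim: j => //= j IH; case: ifP. Qed.

Lemma last_startE j : st j -> last_start j = j.
Proof. by case: j => //= j ->. Qed.

Lemma last_start_ge p i : st p -> (p <= i)%N -> (p <= last_start i)%N.
Proof.
move=> stp; elim: i => [|i IH] /=; first by rewrite leqn0 => /eqP ->.
rewrite leq_eqVlt => /orP[/eqP <-|pi]; first by rewrite stp.
by case: ifP => // _; [exact: ltnW | exact: IH].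
Qed.

Lemma last_start_between p q i j : st p -> st q -> (p <= i < q)%N ->
  last_start j = last_start i -> (p <= j < q)%N.
Proof.
move=> stp stq /andP[pi iq] ji; apply/andP; split.
  apply: leq_trans (last_start_le j); rewrite ji; exact: last_start_ge.
rewrite ltnNge; apply/negP => qj.
have := last_start_ge stq qj; rewrite ji leqNgt => /negP; apply.
exact: leq_ltn_trans (last_start_le i) iq.
Qed.

Definition block_len (a : nat) : nat := \sum_(j < n) (last_start j == a).

Lemma block_len_gt0 j : (j < n)%N -> (0 < block_len (last_start j))%N.
Proof. by move=> jn; rewrite /block_len (bigD1 (Ordinal jn))//= eqxx. Qed.

(** A block never crosses a boundary. The bound [q] may exceed [n], since [block_len] counts only
    positions below [n]. *)
Lemma block_len_le p q i : st p -> st q -> (p <= i < q)%N ->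
  (block_len (last_start i) <= q - p)%N.
Proof.
move=> stp stq piq; rewrite /block_len.
apply: (@leq_trans (\sum_(j < n) (p <= j < q))).
  apply: leq_sum => j _; case: eqP => // ji.
  by rewrite (last_start_between stp stq piq ji).
apply: (@leq_trans (minn n q - p)); last by rewrite leq_sub2r// geq_minr.
elim: (n) => [|k IH]; first by rewrite big_ord0.
rewrite big_ord_recr /=; apply: (leq_trans (leq_add IH (leqnn _))).
by case: (leqP p k) => pk; case: (ltnP k q) => kq; rewrite /= ?addn1 ?addn0; lia.
Qed.

Variable h : nat -> R.

Let len i : R := (block_len (last_start i))%:R.

Let len_gt0 i : (i < n)%N -> 0 < len i.
Proof. by move=> ilt; rewrite ltr0n; exact: block_len_gt0. Qed.

(** The tail is normalised by the length of its whole block, so its norm is at most 1 and the weight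
    of a coefficient depends on the block alone. *)
Definition block_atom (i l : nat) : R :=
  if (last_start l == last_start i) && (i <= l)%N then (Num.sqrt (len i))^-1 else 0.

Definition block_jump (i : nat) : R := if st i then h i else h i - h i.-1.

Definition block_coef (i : nat) : R := Num.sqrt (len i) * block_jump i.

Lemma block_atom_sqnorm i : (i < n)%N -> \sum_(l < n) block_atom i l ^+ 2 <= 1.
Proof.
move=> ilt; have l0 := len_gt0 ilt.
have -> : 1 = \sum_(l < n) (last_start l == last_start i)%:R / len i.
  rewrite -mulr_suml -natr_sum -/(block_len _) divff// gt_eqF//.
apply: ler_sum => l _; rewrite /block_atom; case: eqP => _ /=; last first.
  by rewrite expr0n mul0r.
case: ifP => _; last by rewrite expr0n mul1r invr_ge0 ltW.
by rewrite mul1r exprVn sqr_sqrtr// ltW.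
Qed.

(** Inside a block the increments telescope back to the value at its start. *)
Lemma block_expansion l : (l < n)%N ->
  h l = \sum_(i < n) block_coef i * block_atom i l.
Proof.
move=> ln.
transitivity (\sum_(i < n | (last_start l == last_start i) && (i <= l)%N) block_jump i).
  rewrite -(big_ord_widen_cond n (fun i => last_start l == last_start i) block_jump ln).
  rewrite big_mkcond /=; elim: l ln => [|l IH] ln.
    by rewrite big_ord_recr big_ord0 /= add0r /block_jump st0.
  rewrite big_ord_recr /= eqxx {2}/block_jump.
  case: ifP => sl.
    rewrite big1 ?add0r// => i _; rewrite gtn_eqF//.
    by rewrite ltnS (leq_trans (last_start_le i))// -ltnS.
  by rewrite -IH 1?ltnW//= addrC subrK.
rewrite big_mkcond /=; apply: eq_bigr => i _; rewrite /block_atom.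
case: ifP => _; last by rewrite mulr0.
rewrite /block_coef mulrAC divff ?mul1r// gt_eqF// sqrtr_gt0; exact: len_gt0.
Qed.

(** The variation of [h] inside the block that starts at [a]. *)
Let D a := \sum_(i < n | ~~ st i && (last_start i == a)) `|h i - h i.-1|.

Let start_bound j : (j < n)%N -> `|h (last_start j)| <= `|h j| + D (last_start j).
Proof.
move=> jn; apply: (@le_trans _ _ (`|h j| + \sum_(i < n | (~~ st i &&
   (last_start i == last_start j)) && (i <= j)%N) `|h i - h i.-1|)); last first.
  rewrite lerD2l [leLHS]big_mkcond [leRHS]big_mkcond; apply: ler_sum => i _.
  by case: ifP => [/andP[-> _]//|_]; case: ifP.
rewrite -(big_ord_widen_cond n (fun i => ~~ st i && (last_start i == last_start j))
  (fun i => `|h i - h i.-1|) jn).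
elim: j jn => [|j IH] jn; first by rewrite lerDl sumr_ge0.
have [sj|sj] := boolP (st j.+1).
  by rewrite last_startE// lerDl sumr_ge0.
have -> : last_start j.+1 = last_start j by rewrite /= (negbTE sj).
apply: (le_trans (IH (ltnW jn))).
rewrite [in leRHS]big_mkcond big_ord_recr /= -big_mkcond /= sj (negbTE sj) eqxx /=.
rewrite addrCA [leRHS]addrC lerD2r [leRHS]addrC -lerBlDr -[`|h j.+1 - _|]normrN opprB.
by rewrite lerBlDr; apply: le_trans (ler_normD _ _); rewrite subrK.
Qed.

Let alpha (j : 'I_n) : 'I_n :=
  Ordinal (leq_ltn_trans (last_start_le j) (ltn_ord j)).

Let sum_blocks (P : pred 'I_n) (F : 'I_n -> R) :
  \sum_(a < n | st a) \sum_(j < n | P j && (last_start j == a)) F j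
  = \sum_(j < n | P j) F j.
Proof.
by rewrite [RHS](partition_big alpha (fun a => st a))// => j _; exact: last_start_start.
Qed.

(** A block of length L contributes L terms equal to 1/L. *)
Lemma block_starts_count :
  \sum_(j < n) (len j)^-1 = (\sum_(a < n) st a)%:R.
Proof.
rewrite -(sum_blocks xpredT) natr_sum [RHS](bigID (fun a : 'I_n => st a)) /=.
rewrite [X in _ + X]big1 ?addr0 => [|a /negbTE ->//].
apply: eq_bigr => a sa; rewrite sa (eq_bigr (fun=> (len a)^-1)); last first.
  by move=> j /eqP ja; rewrite /len ja last_startE.
rewrite big_mkcond /= -[RHS](divff (x := len a)) ?gt_eqF ?len_gt0//.
rewrite {2}/len last_startE// /block_len natr_sum mulr_suml.
by apply: eq_bigr => j _; case: eqP; rewrite ?mul1r ?mul0r.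
Qed.

(** At a start [a] of a block of length L, sqrt(L) |h a| is L^(-1/2) times L copies of |h a|, and
    each copy is at most |h j| plus the variation [D a], with j running through the block. The
    variation thus appears a second time with weight sqrt(L), whence the factor 2. *)
Lemma block_coef_sum :
  \sum_(i < n) `|block_coef i| <=
  \sum_(j < n) `|h j| / Num.sqrt (len j)
  + 2 * \sum_(i < n | ~~ st i) Num.sqrt (len i) * `|h i - h i.-1|.
Proof.
have s0 i : 0 <= Num.sqrt (len i) by exact: sqrtr_ge0.
rewrite (bigID (fun a : 'I_n => st a)) /=.
rewrite [X in _ + X](_ : _ = \sum_(i < n | ~~ st i) Num.sqrt (len i) * `|h i - h i.-1|);
  last first.
  by apply: eq_bigr => i si; rewrite /block_coef normrM ger0_norm// /block_jump (negbTE si).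
rewrite mulr2n mulrDl mul1r addrA lerD2r.
rewrite -(sum_blocks xpredT) -(sum_blocks (fun i => ~~ st i)) -big_split /=.
apply: ler_sum => a sa; rewrite /block_coef normrM ger0_norm// /block_jump sa.
have la := len_gt0 (ltn_ord a).
have aE : last_start a = a by rewrite last_startE.
have sl : Num.sqrt (len a) = len a / Num.sqrt (len a).
  by rewrite -{2}(sqr_sqrtr (ltW la)) expr2 mulfK// gt_eqF// sqrtr_gt0.
rewrite [X in X + _](eq_bigr (fun j : 'I_n => `|h j| / Num.sqrt (len a))); last first.
  by move=> j /eqP ja; rewrite /len ja aE.
rewrite [X in _ + X](eq_bigr (fun j : 'I_n => Num.sqrt (len a) * `|h j - h j.-1|));
  last by move=> j /andP[_ /eqP ja]; rewrite /len ja aE.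
rewrite -mulr_sumr -mulr_suml -/(D a) {1 3}sl.
rewrite [leLHS]mulrAC (mulrAC (len a) _ (D a)) -mulrDl ler_pM2r ?invr_gt0 ?sqrtr_gt0//.
rewrite {1 2}/len aE /block_len natr_sum !mulr_suml [X in _ <= X + _]big_mkcond.
rewrite -big_split /=; apply: ler_sum => j _; case: eqP => ja; last by rewrite !mul0r addr0.
by rewrite !mul1r -ja; exact: start_bound.
Qed.

End Blocks.

(** * The dual weight *)

Lemma sqr_sum_orthogonal (R : realType) (I : eqType) (J : seq I) (f : I -> R) :
  uniq J -> {in J &, forall x y, x != y -> f x * f y = 0} ->
  (\sum_(x <- J) f x) ^+ 2 = \sum_(x <- J) f x ^+ 2.
Proof.
elim: J => [|x J IH] /=; first by rewrite !big_nil expr0n.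
move=> /andP[xJ uJ] fo; rewrite !big_cons sqrrD IH//; last first.
  by move=> y z yJ zJ; apply: fo; rewrite inE ?yJ ?zJ orbT.
have -> : f x * \sum_(y <- J) f y = 0; last by rewrite mul0rn addr0.
rewrite mulr_sumr big_seq big1// => y yJ.
apply: fo; rewrite ?inE ?eqxx ?yJ ?orbT//.
by apply/eqP => xy; move: xJ; rewrite xy yJ.
Qed.

Lemma cauchy_schwarz_sum (R : realType) (I : finType) (f g : I -> R) :
  (\sum_i f i * g i) ^+ 2 <= (\sum_i f i ^+ 2) * (\sum_i g i ^+ 2).
Proof.
set F := \sum_i f i ^+ 2; set G := \sum_i g i ^+ 2; set S := \sum_i f i * g i.
have F0 : 0 <= F by apply: sumr_ge0 => i _; exact: sqr_ge0.
have key (t : R) : 0 <= t ^+ 2 * F - 2 * t * S + G.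
  rewrite /F /S /G !mulr_sumr -sumrB -big_split /=.
  apply: sumr_ge0 => i _; rewrite (_ : _ + _ = (t * f i - g i) ^+ 2) ?sqr_ge0//.
  by ring.
have [F00|FN0] := eqVneq F 0.
  rewrite (_ : S = 0) ?expr0n ?F00 ?mul0r// /S big1// => i _.
  have /eqP := F00; rewrite psumr_eq0; last by move=> k _; exact: sqr_ge0.
  by move=> /allP /(_ i); rewrite mem_index_enum sqrf_eq0 => /(_ isT) /eqP ->; rewrite mul0r.
have Fgt0 : 0 < F by rewrite lt0r FN0.
have := key (S / F).
rewrite (_ : _ + G = (F * G - S ^+ 2) / F); last by field.
by rewrite pmulr_lge0 ?invr_gt0// subr_ge0.
Qed.

(** The step 1/(k+1) <= ln((k+1)/k) is ln(1+x) <= x at x = -1/(k+1). *)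
Lemma harmonic_le_ln (R : realType) (n : nat) : (0 < n)%N ->
  \sum_(t < n) (t.+1%:R : R)^-1 <= 1 + ln n%:R.
Proof.
case: n => // n _; elim: n => [|n IH].
  by rewrite big_ord_recr big_ord0 /= add0r ln1 addr0 invr1.
rewrite big_ord_recr /=; apply: (le_trans (lerD IH (lexx _))).
rewrite -addrA lerD2l -lerBrDl -ln_div ?posrE ?ltr0n//.
have := @le_ln1Dx R (- n.+2%:R^-1).
have -> : 1 + - n.+2%:R^-1 = (n.+2%:R / n.+1%:R : R)^-1.
  rewrite invf_div -[n.+2%:R]natr1; move: (ltr0Sn R n); set x := n.+1%:R => x0.
  by field; rewrite gt_eqF// addr_gt0.
rewrite lnV ?posrE ?divr_gt0 ?ltr0n// lerN2; apply.
by rewrite ltrN2 invf_lt1 ?ltr0n// ltr1n.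
Qed.

Section Profile.
Context (R : realType) (lam : nat).
Hypothesis lam0 : (0 < lam)%N.

(** The square root makes the squared increments of order [1 / (lam * t)], hence
    their sum logarithmic, while [1 - profile t] still dominates the square root
    of the length of a block at distance [t]. *)
Definition profile (t : nat) : R := Num.max 0 (1 - Num.sqrt (t%:R / lam%:R)).

Lemma profile_far t : (lam <= t)%N -> profile t = 0.
Proof.
move=> lt; rewrite /profile; apply/max_idPl; rewrite subr_le0.
by rewrite -[leLHS]sqrtr1 ler_wsqrtr// ler_pdivlMr ?ltr0n// mul1r ler_nat.
Qed.

Lemma profile_near t : (t <= lam)%N -> profile t = 1 - Num.sqrt (t%:R / lam%:R).
Proof.
move=> lt; rewrite /profile; apply/max_idPr; rewrite subr_ge0.
by rewrite -[leRHS]sqrtr1 ler_wsqrtr// ler_pdivrMr ?ltr0n// mul1r ler_nat.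
Qed.

Lemma profile_ge0 t : 0 <= profile t. Proof. by rewrite /profile le_max lexx. Qed.

(** With a = (t+1)/lam and b = t/lam, the increment is at most (a - b)/sqrt(a) in absolute value,
    because (sqrt(a) - sqrt(b)) sqrt(a) <= a - b = 1/lam. *)
Lemma profile_step t :
  (profile t.+1 - profile t) ^+ 2 <= (lam%:R * t.+1%:R)^-1.
Proof.
have l0 : (0 : R) < lam%:R by rewrite ltr0n.
have t0 : (0 : R) < t.+1%:R by rewrite ltr0n.
have [lt|tl] := leqP lam t.
  by rewrite !profile_far ?(leqW lt)// subrr expr0n invr_ge0 mulr_ge0// ltW.
rewrite !profile_near ?(ltnW tl)//.
set a := t.+1%:R / lam%:R; set b := t%:R / lam%:R : R.
have a0 : 0 < a by rewrite divr_gt0.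
have b0 : 0 <= b by rewrite divr_ge0.
have ab : b <= a by rewrite ler_pM2r ?invr_gt0// ler_nat.
have sab : Num.sqrt b <= Num.sqrt a by exact: ler_wsqrtr.
have sa : Num.sqrt a ^+ 2 = a by rewrite sqr_sqrtr// ltW.
have sb : Num.sqrt b ^+ 2 = b by rewrite sqr_sqrtr.
have sb0 : 0 <= Num.sqrt b by exact: sqrtr_ge0.
have d : a - b = lam%:R^-1 by rewrite /a /b -mulrBl -natr1 addrAC subrr add0r mul1r.
rewrite (_ : _ - _ = Num.sqrt b - Num.sqrt a); last by ring.
have -> : (lam%:R * t.+1%:R)^-1 = lam%:R^-1 ^+ 2 / a.
  by rewrite /a; field; rewrite !gt_eqF.
rewrite -d ler_pdivlMr//; move: sa sb sb0 sab.
set p := Num.sqrt a; set q := Num.sqrt b => <- <- q0 qp.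
rewrite -exprMn (_ : p ^+ 2 - q ^+ 2 = - ((q - p) * (p + q))); last by ring.
rewrite sqrrN !exprMn ler_wpM2l ?sqr_ge0// ler_sqr ?nnegrE ?addr_ge0//; lra.
Qed.

End Profile.

Definition ndist (i j : nat) : nat := (i - j + (j - i))%N.

Lemma sum_seq_range (V : nmodType) (J : seq nat) (a b : nat) (F : nat -> V) :
  uniq J -> {in J, forall x, a <= x < b}%N ->
  \sum_(a <= i < b | i \in J) F i = \sum_(x <- J) F x.
Proof.
move=> uJ Jab; rewrite -big_filter; apply: perm_big; apply: uniq_perm => //.
  by rewrite filter_uniq// iota_uniq.
move=> x; rewrite mem_filter mem_index_iota.
by case: (boolP (x \in J)) => //= /Jab.
Qed.

Section DualWeight.
Context (R : realType) (n lam : nat) (J : seq nat) (sg h : nat -> R).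
Hypothesis lam0 : (0 < lam)%N.
Hypothesis uJ : uniq J.
Hypothesis sepJ : {in J &, forall x y, x != y -> (2 * lam <= ndist x y)%N}.
Hypothesis bndJ : forall x, x \in J -> (lam <= x)%N /\ (x + lam <= n)%N.
Hypothesis sg2 : forall x, sg x ^+ 2 = 1.

Let nsg x : `|sg x| = 1.
Proof. by apply/eqP; rewrite -sqrp_eq1 ?normr_ge0// real_normK ?num_real// sg2. Qed.

Let pr := profile R lam.

Definition dual_weight (i : nat) : R := \sum_(x <- J) sg x * pr (ndist i x).

(** Bumps of radius lam centred at points 2 lam apart do not overlap, so at most one term
    survives. *)
Lemma dual_weight_cases i : dual_weight i = 0 \/
  exists2 x, x \in J & (ndist i x < lam)%N /\ dual_weight i = sg x * pr (ndist i x).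
Proof.
have [/hasP [x xJ ix]|/hasPn far] := boolP (has (fun x => ndist i x < lam)%N J); last first.
  left; rewrite /dual_weight big_seq big1// => x /far; rewrite -leqNgt => ix.
  by rewrite /pr profile_far// mulr0.
right; exists x => //; split => //.
rewrite /dual_weight (bigD1_seq x)//= big_seq_cond big1 ?addr0// => y /andP[yJ yx].
rewrite /pr profile_far ?mulr0//.
by have := sepJ yJ xJ yx; rewrite /ndist in ix *; lia.
Qed.

Lemma dual_weight_jump x : x \in J -> dual_weight x = sg x.
Proof.
move=> xJ; have xx : ndist x x = 0%N by rewrite /ndist; lia.
rewrite /dual_weight (bigD1_seq x)//= big_seq_cond big1 => [|y /andP[yJ yx]].
  by rewrite addr0 xx /pr profile_near// mul0r sqrtr0 subr0 mulr1.
rewrite /pr profile_far ?mulr0//.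
by have := sepJ yJ xJ yx; rewrite /ndist; lia.
Qed.

Lemma norm_dual_weight_le1 i : `|dual_weight i| <= 1.
Proof.
case: (dual_weight_cases i) => [->|[x xJ [ix ->]]]; first by rewrite normr0.
rewrite normrM nsg mul1r ger0_norm ?profile_ge0// /pr profile_near ?(ltnW ix)//.
Qed.

Let dual_weight0 : dual_weight 0 = 0.
Proof.
rewrite /dual_weight big_seq big1// => x /bndJ [? ?].
by rewrite /pr profile_far ?mulr0// /ndist; lia.
Qed.

Let dual_weightn : dual_weight n = 0.
Proof.
rewrite /dual_weight big_seq big1// => x /bndJ [? ?].
by rewrite /pr profile_far ?mulr0// /ndist; lia.
Qed.

Lemma abel_sum (w : nat -> R) k :
  \sum_(i < k.+1) h i * (w i.+1 - w i)
  = - \sum_(1 <= i < k.+1) w i * (h i - h i.-1) + w k.+1 * h k - w 0%N * h 0%N.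
Proof.
elim: k => [|k IH]; first by rewrite big_ord_recr big_ord0 /= big_geq//; ring.
rewrite big_ord_recr /= IH [in RHS]big_nat_recr//=; ring.
Qed.

Hypothesis descent :
  \sum_(1 <= i < n | i \notin J) `|h i - h i.-1|
  <= - \sum_(x <- J) sg x * (h x - h x.-1).

(** Summation by parts, without boundary terms since the weight vanishes at 0 and [n]. On the jumps
    the weight is [sg], so [descent] applies; off the jumps it takes away at most its absolute value
    times the increment. *)
Lemma descent_weighted : (0 < n)%N ->
  \sum_(1 <= i < n | i \notin J) (1 - `|dual_weight i|) * `|h i - h i.-1|
  <= \sum_(i < n) h i * (dual_weight i.+1 - dual_weight i).
Proof.
move=> n0'; have := abel_sum dual_weight n.-1.
rewrite prednK// dual_weight0 dual_weightn !mul0r subr0 addr0 => ->.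
rewrite [X in - X](bigID (mem J)) /= opprD.
have -> : \sum_(1 <= i < n | i \in J) dual_weight i * (h i - h i.-1)
   = \sum_(x <- J) sg x * (h x - h x.-1).
  rewrite (eq_bigr (fun i => sg i * (h i - h i.-1))); last first.
    by move=> i iJ; rewrite dual_weight_jump.
  by apply: sum_seq_range => // x /bndJ [? ?]; lia.
apply: le_trans (lerB descent (lexx _)).
rewrite -sumrB; apply: ler_sum => i _; rewrite mulrBl mul1r lerD2l lerN2.
by rewrite -normrM ler_norm.
Qed.

Let grad_profile x : x \in J ->
  \sum_(i < n) (pr (ndist i.+1 x) - pr (ndist i x)) ^+ 2
  <= 2 * (lam%:R^-1 * (1 + ln n%:R)).
Proof.
move=> xJ; have [lx xn] := bndJ xJ.
have n0' : (0 < n)%N by lia.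
have xn' : (x <= n)%N by lia.
pose f (t : nat) : R := (lam%:R * t.+1%:R)^-1.
have f0 t : 0 <= f t by rewrite invr_ge0 mulr_ge0.
have fsum k : (k <= n)%N -> \sum_(0 <= t < k) f t <= lam%:R^-1 * (1 + ln n%:R).
  move=> kn; apply: (@le_trans _ _ (\sum_(0 <= t < n) f t)).
    by rewrite [leRHS](big_cat_nat _ (n := k))//= lerDl sumr_ge0.
  rewrite big_mkord /f; under eq_bigr do rewrite invfM.
  by rewrite -mulr_sumr ler_wpM2l ?invr_ge0// harmonic_le_ln.
rewrite -(big_mkord xpredT (fun i => (pr (ndist i.+1 x) - pr (ndist i x)) ^+ 2)).
rewrite (big_cat_nat _ (n := x))//= mulr2n mulrDl mul1r.
apply: lerD.
  apply: le_trans (fsum x xn'); rewrite [leRHS]big_nat_rev /= add0n.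
  rewrite !big_seq; apply: ler_sum => i; rewrite mem_index_iota => /andP[_ ix].
  have -> : ndist i.+1 x = (x - i.+1)%N by rewrite /ndist; lia.
  have -> : ndist i x = (x - i.+1).+1 by rewrite /ndist; lia.
  by rewrite -sqrrN opprB; exact: profile_step.
apply: le_trans (fsum (n - x)%N (leq_subr _ _)).
rewrite -{1}[x]add0n big_addn !big_seq; apply: ler_sum => i _.
have -> : ndist (i + x).+1 x = i.+1 by rewrite /ndist; lia.
have -> : ndist (i + x) x = i by rewrite /ndist; lia.
exact: profile_step.
Qed.

Lemma grad_dual_weight :
  \sum_(i < n) (dual_weight i.+1 - dual_weight i) ^+ 2
  <= (size J)%:R * (2 * (lam%:R^-1 * (1 + ln n%:R))).
Proof.
rewrite (eq_bigr (fun i : 'I_n =>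
    \sum_(x <- J) (pr (ndist i.+1 x) - pr (ndist i x)) ^+ 2)); last first.
  move=> i _; rewrite /dual_weight -sumrB.
  under eq_bigr do rewrite -mulrBr.
  rewrite sqr_sum_orthogonal//.
    by apply: eq_bigr => x _; rewrite exprMn sg2 mul1r.
  move=> x y xJ yJ xy; have := sepJ xJ yJ xy => xyl.
  (* If [i] or [i.+1] is closer than lam to [x], both are within lam of [x], hence at least lam away
     from [y], where the profile already vanishes. *)
  have [xi|xi] := leqP lam (minn (ndist i x) (ndist i.+1 x)).
    by rewrite {1 2}/pr !profile_far ?subrr ?mulr0 ?mul0r//; lia.
  rewrite {3 4}/pr !profile_far ?subrr ?mulr0//;
    by rewrite /ndist in xyl xi *; lia.
rewrite exchange_big /=; set c := 2 * _.
apply: (@le_trans _ _ (\sum_(x <- J) c)).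
  by rewrite !big_seq; apply: ler_sum => x xJ; exact: grad_profile.
by rewrite big_const_seq count_predT iter_addr_0 mulr_natl.
Qed.

(** The weight satisfies sqrt(ell i) <= sqrt(lam) (1 - |w i|): near a jump the right side is the
    square root of the distance, and where w vanishes it is sqrt(lam). Cauchy-Schwarz against the
    increments of w then brings a factor 1/lam, which cancels lam. *)
Lemma interior_sum (st : pred nat) (ell : nat -> nat) : st 0 ->
  {in J, forall x, st x} ->
  (forall i, (i < n)%N -> ~~ st i ->
     (ell i <= lam)%N /\ {in J, forall x, ell i <= ndist i x}%N) ->
  (\sum_(i < n | ~~ st i) Num.sqrt (ell i)%:R * `|h i - h i.-1|) ^+ 2
  <= 2 * (size J)%:R * (1 + ln n%:R) * \sum_(i < n) h i ^+ 2.
Proof.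
move=> st0 stJ ellP; have [n00|npos] := posnP n.
  have z (F : 'I_n -> R) P : \sum_(i < n | P i) F i = 0.
    by rewrite big1// => i _; have := ltn_ord i; rewrite {2}n00.
  by rewrite !z expr0n mulr0.
have l0 : (0 : R) < lam%:R by rewrite ltr0n.
set I := \sum_(i < n | _) _.
have I0 : 0 <= I by apply: sumr_ge0 => i _; rewrite mulr_ge0 ?sqrtr_ge0.
pose g (i : 'I_n) := dual_weight i.+1 - dual_weight i.
set X := \sum_(i < n) h i * g i.
have IX : I <= Num.sqrt lam%:R * X.
  apply: (@le_trans _ _ (Num.sqrt lam%:R *
      \sum_(1 <= i < n | i \notin J) (1 - `|dual_weight i|) * `|h i - h i.-1|)); last first.
    by rewrite ler_wpM2l ?sqrtr_ge0// descent_weighted.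
  rewrite /I -(big_mkord (fun i => ~~ st i) (fun i => Num.sqrt (ell i)%:R * `|h i - h i.-1|)).
  rewrite big_ltn_cond// st0 /= mulr_sumr [leLHS]big_mkcond [leRHS]big_mkcond.
  rewrite !big_seq; apply: ler_sum => i; rewrite mem_index_iota => /andP[_ ilt].
  have w1 : 0 <= 1 - `|dual_weight i| by rewrite subr_ge0 norm_dual_weight_le1.
  have [sti|sti] := boolP (st i) => /=.
    by case: ifP => // _; rewrite !mulr_ge0 ?sqrtr_ge0.
  have -> : i \notin J by apply: contra sti; exact: stJ.
  rewrite mulrA ler_wpM2r//; have [el ed] := ellP i ilt sti.
  case: (dual_weight_cases i) => [->|[x xJ [ix ->]]].
    by rewrite normr0 subr0 mulr1 ler_wsqrtr// ler_nat.
  rewrite normrM nsg mul1r ger0_norm ?profile_ge0// /pr profile_near ?(ltnW ix)//.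
  rewrite opprB addrC subrK -sqrtrM// mulrC divfK ?gt_eqF// ler_wsqrtr// ler_nat.
  exact: ed.
have X2 : X ^+ 2 <= (\sum_(i < n) h i ^+ 2) * \sum_(i < n) g i ^+ 2.
  exact: (cauchy_schwarz_sum (fun i : 'I_n => h i)).
have H0 : 0 <= \sum_(i < n) h i ^+ 2 by apply: sumr_ge0 => i _; exact: sqr_ge0.
apply: (@le_trans _ _ (lam%:R * X ^+ 2)).
  rewrite -{1}(sqr_sqrtr (ltW l0)) -exprMn ler_sqr ?nnegrE//.
  exact: le_trans IX.
apply: (@le_trans _ _ (lam%:R * ((\sum_(i < n) h i ^+ 2) *
    ((size J)%:R * (2 * (lam%:R^-1 * (1 + ln n%:R))))))).
  rewrite ler_pM2l//; apply: (le_trans X2); rewrite ler_wpM2l//.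
  exact: grad_dual_weight.
rewrite le_eqVlt; apply/orP; left; apply/eqP.
by field; rewrite gt_eqF.
Qed.

End DualWeight.

(** * Block boundaries *)

Definition pow2_or0 (t : nat) : bool := (t == 0)%N || (t == 2 ^ trunc_log 2 t)%N.

Lemma pow2_or0X k : pow2_or0 (2 ^ k).
Proof. by rewrite /pow2_or0 trunc_expnK// eqxx orbT. Qed.

Lemma pow2_or0_bracket t : ~~ pow2_or0 t ->
  exists k, (2 ^ k < t < 2 ^ k.+1)%N.
Proof.
rewrite negb_or -lt0n => /andP[t0 tk]; exists (trunc_log 2 t).
by rewrite trunc_log_ltn// andbT ltn_neqAle eq_sym tk trunc_logP.
Qed.

Lemma count_pow2_or0 n : (\sum_(t < n) pow2_or0 t <= trunc_log 2 n + 2)%N.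
Proof.
rewrite -(big_mkord xpredT (fun t => pow2_or0 t : nat)).
rewrite -big_mkcond /= sum1_count -size_filter.
have -> : (trunc_log 2 n + 2)%N = size (0%N :: [seq (2 ^ k)%N | k <- iota 0 (trunc_log 2 n).+1]).
  by rewrite /= size_map size_iota addn2.
apply: uniq_leq_size; first by rewrite filter_uniq// iota_uniq.
move=> t; rewrite mem_filter mem_index_iota => /andP[/orP[/eqP ->|/eqP tE] tn].
  by rewrite inE eqxx.
rewrite inE; apply/orP; right; rewrite tE; apply: map_f; rewrite mem_iota add0n /=.
by rewrite ltnS leq_trunc_log// ltnW.
Qed.

Section Starts.
Context (R : realType) (n lam : nat) (J : seq nat).
Hypothesis lam0 : (0 < lam)%N.
Hypothesis Jn : forall x, x \in J -> (x < n)%N.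

(** Every jump [x] contributes boundaries, not only the nearest one: an interior
    point is then enclosed by the boundaries at [2 ^ k] and [2 ^ k.+1] from [x]. *)
Definition starts (i : nat) : bool :=
  (lam %| i)%N || has (fun x => pow2_or0 (ndist i x)) J.

Lemma starts0 : starts 0. Proof. by rewrite /starts dvdn0. Qed.

Lemma starts_jump x : x \in J -> starts x.
Proof.
move=> xJ; apply/orP; right; apply/hasP; exists x => //.
by rewrite /ndist subnn.
Qed.

Let starts_pow x i k : x \in J -> ndist i x = (2 ^ k)%N -> starts i.
Proof.
move=> xJ e; apply/orP; right; apply/hasP; exists x => //.
by rewrite e pow2_or0X.
Qed.

(** Consecutive multiples of lam enclose [i] in a range of length lam. If the distance to [x] lies
    strictly between 2^k and 2^(k+1), the boundaries at these two distances enclose [i] in a range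
    of length 2^k, less than the distance. *)
Lemma block_len_starts i : ~~ starts i ->
  (block_len n starts (last_start starts i) <= lam)%N /\
  {in J, forall x, block_len n starts (last_start starts i) <= ndist i x}%N.
Proof.
move=> sti; split.
  have := @block_len_le n starts starts0 (i %/ lam * lam) (i %/ lam * lam + lam) i.
  rewrite addKn; apply; rewrite /starts ?dvdn_addr ?dvdn_mull ?dvdnn//.
  by rewrite leq_divM /= addnC -mulSn ltn_ceil.
move=> x xJ; move: (sti); rewrite negb_or => /andP[_ /hasPn /(_ x xJ)].
move=> /pow2_or0_bracket [k /andP[k1 k2]].
have k0 : (0 < 2 ^ k)%N by rewrite expn_gt0.
have kS : (2 ^ k.+1 = 2 * 2 ^ k)%N by rewrite expnS.
have [xi|ix] := leqP x i.
  apply: leq_trans (ltnW k1).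
  have := @block_len_le n starts starts0 (x + 2 ^ k) (x + 2 ^ k.+1) i.
  rewrite subnDl kS (_ : (2 * 2 ^ k - 2 ^ k = 2 ^ k)%N); last by lia.
  apply.
  - by apply: (starts_pow xJ (k := k)); rewrite /ndist; lia.
  - by apply: (starts_pow xJ (k := k.+1)); rewrite /ndist; lia.
  - by rewrite /ndist in k1 k2; lia.
apply: leq_trans (ltnW k1).
have [xk|xk] := leqP (2 ^ k.+1) x.
  have := @block_len_le n starts starts0 (x - 2 ^ k.+1) (x - 2 ^ k) i.
  rewrite (_ : (x - 2 ^ k - (x - 2 ^ k.+1) = 2 ^ k)%N); last by lia.
  apply.
  - by apply: (starts_pow xJ (k := k.+1)); rewrite /ndist; lia.
  - by apply: (starts_pow xJ (k := k)); rewrite /ndist; lia.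
  - by rewrite /ndist in k1 k2; lia.
(* The outer boundary would lie left of 0, so 0 replaces it; the range has length x - 2^k < 2^k. *)
have := @block_len_le n starts starts0 0 (x - 2 ^ k) i.
rewrite subn0 => H; apply: leq_trans (H _ _ _) _.
- exact: starts0.
- by apply: (starts_pow xJ (k := k)); rewrite /ndist in k1 k2 *; lia.
- by rewrite /ndist in k1 k2; lia.
- lia.
Qed.

Lemma count_starts :
  (\sum_(a < n) starts a
   <= (n %/ lam).+1 + size J * (2 * (trunc_log 2 n + 2)))%N.
Proof.
apply: (@leq_trans (\sum_(a < n) (lam %| a)%N
    + \sum_(a < n) \sum_(x <- J) pow2_or0 (ndist a x))).
  rewrite -big_split /=; apply: leq_sum => a _; rewrite /starts.
  case: (lam %| a)%N => //=; case: hasP => // -[x xJ px].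
  by rewrite add0n (big_rem x)//= px.
apply: leq_add.
  rewrite -(big_mkord xpredT (fun a => (lam %| a)%N : nat)).
  rewrite -big_mkcond /= sum1_count -size_filter.
  have -> : (n %/ lam).+1 = size [seq (q * lam)%N | q <- iota 0 (n %/ lam).+1].
    by rewrite size_map size_iota.
  apply: uniq_leq_size; first by rewrite filter_uniq// iota_uniq.
  move=> a; rewrite mem_filter mem_index_iota => /andP[/dvdnP [q ->] qn].
  apply: (map_f (fun q => (q * lam)%N)); rewrite mem_iota add0n ltnS leq_divRL//.
  by case/andP: qn => _ /ltnW.
rewrite exchange_big /= -sum1_size big_distrl /=.
rewrite !big_seq; apply: leq_sum => x xJ; rewrite mul1n.
have xn : (x <= n)%N by exact/ltnW/Jn.
rewrite -(big_mkord xpredT (fun a => pow2_or0 (ndist a x) : nat)).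
rewrite (big_cat_nat _ (n := x))//= mul2n -addnn.
have cnt k : (k <= n)%N -> (\sum_(0 <= t < k) pow2_or0 t <= trunc_log 2 n + 2)%N.
  move=> kn; apply: leq_trans (count_pow2_or0 n).
  rewrite -(big_mkord xpredT (fun t => pow2_or0 t : nat)).
  by rewrite [leqRHS](big_cat_nat _ (n := k))//= leq_addr.
apply: leq_add.
  (* To the left of [x] the distances are 1, ..., x; the sum is completed by the distance 0. *)
  apply: leq_trans (cnt x.+1 _); last exact: Jn.
  rewrite big_nat_rev /= add0n [leqRHS]big_ltn//= [leqRHS]addnC.
  rewrite big_add1 /=; apply: leq_trans (leq_addr _ _).
  rewrite !big_seq; apply: leq_sum => t; rewrite mem_index_iota => /andP[_ tx].
  by rewrite (_ : ndist _ _ = t.+1)// /ndist; lia.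
apply: leq_trans (cnt (n - x)%N (leq_subr _ _)).
rewrite -{1}[x]add0n big_addn; apply: leq_sum => t _.
by rewrite (_ : ndist _ _ = t)// /ndist; lia.
Qed.

End Starts.

(** * Total variation and jumps *)

(** Cauchy-Schwarz bounds B^2 by the number of blocks, the dual weight bounds I^2; the constants
    come from (B + 2I)^2 <= 2 B^2 + 8 I^2. *)
Lemma block_coef_bound (R : realType) (n lam : nat) (J : seq nat)
    (sg h : nat -> R) :
  (0 < lam)%N -> uniq J ->
  {in J &, forall x y, x != y -> (2 * lam <= ndist x y)%N} ->
  (forall x, x \in J -> (lam <= x)%N /\ (x + lam <= n)%N) ->
  (forall x, sg x ^+ 2 = 1) ->
  \sum_(1 <= i < n | i \notin J) `|h i - h i.-1|
    <= - \sum_(x <- J) sg x * (h x - h x.-1) ->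
  (\sum_(i < n) `|block_coef n (starts lam J) h i|) ^+ 2
  <= (2 * (\sum_(a < n) starts lam J a)%:R + 16 * (size J)%:R * (1 + ln n%:R))
     * \sum_(i < n) h i ^+ 2.
Proof.
move=> lam0 uJ sepJ bndJ sg2 descent; set st := starts lam J.
have st0 : st 0 := starts0 lam J.
set H := \sum_(i < n) h i ^+ 2.
pose len i : R := (block_len n st (last_start st i))%:R.
pose B := \sum_(j < n) `|h j| / Num.sqrt (len j).
pose I := \sum_(i < n | ~~ st i) Num.sqrt (len i) * `|h i - h i.-1|.
have I2 : I ^+ 2 <= 2 * (size J)%:R * (1 + ln n%:R) * H.
  apply: (interior_sum (ell := fun i => block_len n st (last_start st i))
    lam0 uJ sepJ bndJ sg2 descent st0) => [x xJ|i _ sti].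
    exact: starts_jump.
  exact: block_len_starts.
have B2 : B ^+ 2 <= (\sum_(a < n) st a)%:R * H.
  rewrite mulrC -(block_starts_count R n st0).
  apply: (le_trans (cauchy_schwarz_sum (fun i : 'I_n => `|h i|) _)).
  rewrite (eq_bigr (fun i : 'I_n => h i ^+ 2)); last first.
    by move=> i _; rewrite real_normK ?num_real.
  rewrite [X in _ * X](eq_bigr (fun i : 'I_n => (len i)^-1))// => i _.
  by rewrite exprVn sqr_sqrtr// ler0n.
have B0 : 0 <= B by apply: sumr_ge0 => i _; rewrite divr_ge0 ?sqrtr_ge0.
have I0 : 0 <= I by apply: sumr_ge0 => i _; rewrite mulr_ge0 ?sqrtr_ge0.
have C0 : 0 <= \sum_(i < n) `|block_coef n st h i| by apply: sumr_ge0.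
apply: (@le_trans _ _ ((B + 2 * I) ^+ 2)).
  rewrite ler_sqr ?nnegrE ?addr_ge0 ?mulr_ge0//.
  exact: block_coef_sum.
apply: (@le_trans _ _ (2 * B ^+ 2 + 8 * I ^+ 2)).
  rewrite -subr_ge0 (_ : _ - _ = (B - 2 * I) ^+ 2) ?sqr_ge0//; ring.
rewrite [leRHS]mulrDl; apply: lerD; first by rewrite -mulrA ler_pM2l.
apply: (@le_trans _ _ (8 * (2 * (size J)%:R * (1 + ln n%:R) * H))).
  by rewrite ler_pM2l.
by rewrite le_eqVlt; apply/orP; left; apply/eqP; ring.
Qed.

Section JumpSet.
Context (R : realType) (n : nat).
Hypothesis n1 : (0 < n)%N.
Implicit Type x : 'I_n.-1.+1 -> R.

(** Edges are numbered by their right endpoint, as in [jump_set]. *)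
Definition grad x (i : nat) : R := x (inord i) - x (inord i.-1).

Lemma tv_normE x : tv_norm x = \sum_(1 <= i < n) `|grad x i|.
Proof. by rewrite /tv_norm big_add1. Qed.

Lemma mem_jump_set x i : (i \in jump_set x) = (0 < i < n)%N && (grad x i != 0).
Proof.
rewrite /jump_set; apply/mapP/andP => [[k]|[/andP[i0 ilt] g]].
  rewrite mem_filter mem_iota add0n /= => /andP[g kn] ->; split; first by lia.
  by rewrite /grad subr_eq0.
exists i.-1; last by rewrite prednK.
rewrite mem_filter mem_iota add0n prednK//.
by move: g; rewrite /grad subr_eq0 => ->; lia.
Qed.

Lemma jump_set_sorted x : sorted ltn (jump_set x).
Proof.
rewrite /jump_set; apply: (homo_sorted (e := ltn)) => [i j|] //=.
by apply: sorted_filter; [exact: ltn_trans | exact: iota_ltn_sorted].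
Qed.

Lemma jump_set_uniq x : uniq (jump_set x).
Proof.
apply: sorted_uniq (jump_set_sorted x); [exact: ltn_trans | exact: ltnn].
Qed.

(** The value 1 where the gradient vanishes makes the square equal to 1 everywhere. *)
Definition jump_sign x (i : nat) : R := if 0 <= grad x i then 1 else -1.

Lemma jump_sign_sqr x i : jump_sign x i ^+ 2 = 1.
Proof. by rewrite /jump_sign; case: ifP => _; rewrite ?expr1n// sqrrN expr1n. Qed.

(** At a jump, |grad z| >= sign * grad z = |grad x| + sign * (grad z - grad x); elsewhere grad x =
    0. *)
Lemma tv_descent x z : tv_norm z <= tv_norm x ->
  \sum_(1 <= i < n | i \notin jump_set x) `|grad z i - grad x i|
  <= - \sum_(i <- jump_set x) jump_sign x i * (grad z i - grad x i).
Proof.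
have Jr : {in jump_set x, forall i, 1 <= i < n}%N.
  by move=> i; rewrite mem_jump_set => /andP[].
rewrite -(sum_seq_range _ (jump_set_uniq x) Jr) !tv_normE.
rewrite (bigID (mem (jump_set x))) [leRHS](bigID (mem (jump_set x))) /=.
rewrite [X in _ <= _ + X]big_nat_cond [X in _ <= _ + X]big1 ?addr0; last first.
  move=> i /andP[ir]; rewrite mem_jump_set ir /= negbK => /eqP ->.
  by rewrite normr0.
move=> tvle.
have out : \sum_(1 <= i < n | i \notin jump_set x) `|grad z i - grad x i|
    = \sum_(1 <= i < n | i \notin jump_set x) `|grad z i|.
  rewrite big_nat_cond [RHS]big_nat_cond; apply: eq_bigr => i /andP[ir].
  by rewrite mem_jump_set ir /= negbK => /eqP ->; rewrite subr0.
rewrite out -sumrN; set a := \sum_(_ <= i < n | _) `|grad x i| in tvle *.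
set b := \sum_(_ <= i < n | _) `|grad z i| in tvle *.
have : a + \sum_(1 <= i < n | i \in jump_set x) jump_sign x i * (grad z i - grad x i)
    <= \sum_(1 <= i < n | i \in jump_set x) `|grad z i|.
  rewrite -big_split /=; apply: ler_sum => i _; rewrite /jump_sign.
  case: ifP => [g0|/negbT]; first by rewrite ger0_norm// mul1r addrC subrK ler_norm.
  rewrite -ltNge => g0; rewrite ltr0_norm//.
  by have := ler_norm (- grad z i); rewrite normrN; lra.
rewrite sumrN; lra.
Qed.

End JumpSet.

(** * Distances between jumps of a separated signal *)

Section Separation.
Context (R : realType) (n : nat) (x : 'I_n.-1.+1 -> R) (Delta : R).
Hypothesis n1 : (0 < n)%N.
Hypothesis sepx : delta_separated Delta x.

Let s := size (jump_set x).
Let nu := 0%N :: jump_set x ++ [:: n].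
Let gap : R := Delta * n%:R / s.+1%:R.

Let nu_sorted : sorted ltn nu.
Proof.
rewrite /nu /= cat_path /= andbT path_sortedE; last exact: ltn_trans.
rewrite jump_set_sorted andbT; apply/andP; split.
  by apply/allP => i; rewrite mem_jump_set// => /andP[/andP[]].
have := mem_last 0%N (jump_set x); rewrite inE => /orP[/eqP -> //|].
by rewrite mem_jump_set// => /andP[/andP[]].
Qed.

Let nu_gap i j : (i <= j <= s.+1)%N ->
  (j - i)%:R * gap <= (nth 0%N nu j)%:R - (nth 0%N nu i)%:R.
Proof.
move=> /andP[]; elim: j => [|j IH].
  by rewrite leqn0 => /eqP -> _; rewrite subnn mul0r subrr.
rewrite leq_eqVlt => /orP[/eqP ->|]; first by rewrite subnn mul0r subrr.
rewrite ltnS => ij js; rewrite subSn// -natr1 mulrDl mul1r.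
have := sepx js; rewrite -/nu -/s.
have lt : (nth 0%N nu j < nth 0%N nu j.+1)%N.
  apply: (sortedP 0%N nu_sorted).
  by rewrite /nu /= size_cat addn1.
rewrite ger0_norm ?subr_ge0 ?ler_nat ?(ltnW lt)// ler_pdivlMr ?ltr0n// => g.
have {}g : gap <= (nth 0%N nu j.+1)%:R - (nth 0%N nu j)%:R.
  by apply: le_trans g; rewrite /gap mulrAC.
by have := IH ij (ltnW js); lra.
Qed.

(** The s + 1 consecutive gaps telescope to n. This is what forces Delta <= 1. *)
Lemma gap_total : s.+1%:R * gap <= n%:R.
Proof.
have := @nu_gap 0 s.+1; rewrite leqnn => /(_ isT).
by rewrite subn0 subr0 /nu /= nth_cat ltnn subnn.
Qed.

Let nu_index i : i \in jump_set x ->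
  nth 0%N nu (index i (jump_set x)).+1 = i /\ (index i (jump_set x) < s)%N.
Proof.
move=> iJ; have lt : (index i (jump_set x) < s)%N by rewrite index_mem.
by rewrite /nu /= nth_cat lt nth_index.
Qed.

Hypothesis gap0 : 0 <= gap.

Lemma gap_left i : i \in jump_set x -> gap <= i%:R.
Proof.
move=> /nu_index [nui lt]; have h : (0 <= (index i (jump_set x)).+1 <= s.+1)%N by lia.
have := nu_gap h; rewrite nui subn0 subr0; apply: le_trans.
by rewrite ler_peMl// ler1n.
Qed.

Lemma gap_right i : i \in jump_set x -> gap <= n%:R - i%:R.
Proof.
move=> /nu_index [nui lt]; have h : ((index i (jump_set x)).+1 <= s.+1 <= s.+1)%N by lia.
have := nu_gap h; rewrite nui.
rewrite /nu /= nth_cat ltnn subnn /=; apply: le_trans.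
by rewrite ler_peMl// ler1n subSS subn_gt0.
Qed.

Lemma gap_between : {in jump_set x &, forall i j, (i < j)%N -> gap <= j%:R - i%:R}.
Proof.
move=> i j /nu_index [nui lti] /nu_index [nuj ltj] ij.
have [kl|lk] := ltnP (index i (jump_set x)) (index j (jump_set x)).
  have h : ((index i (jump_set x)).+1 <= (index j (jump_set x)).+1 <= s.+1)%N by lia.
  have := nu_gap h; rewrite nui nuj; apply: le_trans.
  by rewrite ler_peMl// ler1n subSS subn_gt0.
(* Indices ordered against the values are impossible: [nu_gap] would give j <= i. *)
have h' : ((index j (jump_set x)).+1 <= (index i (jump_set x)).+1 <= s.+1)%N by lia.
have := nu_gap h'; rewrite nui nuj => h.
have : (0 : R) <= i%:R - j%:R by apply: le_trans h; rewrite mulr_ge0.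
by rewrite subr_ge0 ler_nat leqNgt ij.
Qed.

End Separation.

(** * Union bound and logarithms *)

Lemma union_bound (R : realType) (d : measure_display) (T : measurableType d)
    (P : probability T R) (I : Type) (r : seq I) (bad : I -> set T) (c : R) :
  (forall k, measurable (bad k)) -> (forall k, P (bad k) <= c%:E)%E ->
  (P (\big[setU/set0]_(k <- r) bad k) <= ((size r)%:R * c)%:E)%E.
Proof.
move=> mbad badc; elim: r => [|k r IH]; first by rewrite big_nil measure0 mul0r.
rewrite big_cons /= -natr1 mulrDl mul1r addrC EFinD.
apply: (le_trans (measureU2 _ _ _)) => //.
  exact: bigsetU_measurable.
by apply: leeD; [exact: badc|exact: IH].
Qed.

Lemma ln2_ge_half (R : realType) : 1 / 2 <= ln (2 : R).
Proof.
have := @le_ln1Dx R (- (1 / 2)).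
rewrite (_ : 1 - 1 / 2 = 2^-1); last by field.
by rewrite lnV ?posrE// lerN2; apply; lra.
Qed.

Lemma trunc_log2_le_ln (R : realType) (n : nat) : (0 < n)%N ->
  (trunc_log 2 n)%:R <= 2 * ln (n%:R : R).
Proof.
move=> n0; have h : ln (2 : R) * (trunc_log 2 n)%:R <= ln n%:R.
  rewrite mulr_natr -lnXn// -natrX ler_ln ?posrE ?ltr0n ?expn_gt0//.
  by rewrite ler_nat trunc_logP.
have := ln2_ge_half R; have t0 : (0 : R) <= (trunc_log 2 n)%:R by [].
move=> l2; have : 1 / 2 * (trunc_log 2 n)%:R <= ln (2 : R) * (trunc_log 2 n)%:R.
  by rewrite ler_wpM2r.
lra.
Qed.

(** * Recovery *)

(** Take lam = floor(g/2): it exceeds g/2 - 1, which is at least g/4 once g >= 4. *)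
Lemma nat_half_approx (R : realType) (g : R) : 4 <= g ->
  exists lam : nat, [/\ (0 < lam)%N, 2 * lam%:R <= g & g <= 4 * lam%:R].
Proof.
move=> g4; have g0 : 0 <= g / 2 by lra.
have /andP[t1 t2] := Num.Theory.truncn_itv g0.
have {}t2 : g / 2 < (Num.truncn (g / 2))%:R + 1 by rewrite natr1.
by exists (Num.truncn (g / 2)); split; [rewrite -(ltr0n R)| |]; lra.
Qed.

Lemma starts_count_bound (R : realType) (n lam : nat) (J : seq nat) (Delta : R) :
  let s : R := (size J)%:R in
  (2 <= n)%N -> (0 < size J)%N -> (0 < lam)%N -> 0 < Delta -> Delta <= 1 ->
  Delta * n%:R / (size J).+1%:R <= 4 * lam%:R ->
  (forall x, x \in J -> (x < n)%N) ->
  2 * (\sum_(a < n) starts lam J a)%:R + 16 * s * (1 + ln n%:R)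
  <= 108 * (Delta^-1 * s * ln n%:R).
Proof.
move=> s n2 s0 lam0 D0 D1 gl Jn.
have s1 : 1 <= s by rewrite ler1n.
have l0 : (0 : R) < lam%:R by rewrite ltr0n.
have lnn : 1 / 2 <= ln (n%:R : R).
  by apply: le_trans (ln2_ge_half R) _; rewrite ler_ln ?posrE ?ltr0n ?ler_nat//; lia.
have D1' : 1 <= Delta^-1 by rewrite invf_ge1.
have dl : (n %/ lam)%:R <= 4 * (Delta^-1 * (s + 1)).
  apply: (@le_trans _ _ (n%:R / lam%:R)).
    by rewrite ler_pdivlMr// -natrM ler_nat leq_divM.
  rewrite ler_pdivrMr//.
  have -> : n%:R = Delta^-1 * (s + 1) * (Delta * n%:R / (size J).+1%:R).
    rewrite -natr1 -/s; field; rewrite gt_eqF//=; first by rewrite gt_eqF//; lra.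
  rewrite [leRHS](_ : _ = Delta^-1 * (s + 1) * (4 * lam%:R)); last by ring.
  by rewrite ler_wpM2l// mulr_ge0 ?invr_ge0 ?(ltW D0)//; lra.
have cnt : (\sum_(a < n) starts lam J a)%:R <=
    (n %/ lam)%:R + 1 + s * (2 * ((trunc_log 2 n)%:R + 2)).
  rewrite /s -[1]/(1%:R) -!natrD -!natrM -natrD ler_nat addn1.
  exact: count_starts.
have tl := trunc_log2_le_ln R (ltnW n2).
have stl : s * (2 * ((trunc_log 2 n)%:R + 2)) <= s * (2 * (2 * ln n%:R + 2)).
  by rewrite ler_wpM2l ?ler_pM2l ?lerD2r//; lra.
set l := ln n%:R in lnn tl stl *; set D := Delta^-1 in D1' dl *.
(* Every term is compared with D s l using s >= 1, D >= 1 and l >= 1/2: 8 D (s + 1) counts for 32,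
   the constant 2 for 4, 8 s l + 8 s for 24, and 16 s (1 + l) for 48, in total 108. *)
have sl : s <= 2 * (s * l) by nra.
have Dsl : s * l <= D * s * l by nra.
have Ds : D * s <= 2 * (D * s * l) by nra.
nra.
Qed.

Definition tv_atom (R : realType) (n lam : nat) (J : seq nat)
    (i l : 'I_n.-1.+1) : R := block_atom R n (starts lam J) i l.

Lemma tv_atom_sqnorm (R : realType) (n lam : nat) (J : seq nat) (i : 'I_n.-1.+1) :
  (0 < n)%N -> sqnorm (tv_atom R lam J i) <= 1.
Proof.
case: n i => // n i _; apply: block_atom_sqnorm => //; exact: starts0.
Qed.

(** The deterministic half: randomness will enter only through the bounds on the atoms and on their
    signed sums. A competitor [z] yields h = z - xs in the kernel of [A] with the descent property,
    so [kernel_trivial] applies. *)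
Lemma tv_unique (R : realType) (m n M lam : nat) (xs : 'I_n.-1.+1 -> R)
    (A : 'I_m -> 'I_n.-1.+1 -> R) :
  let J := jump_set xs in
  (0 < m)%N -> (0 < n)%N -> (0 < lam)%N ->
  {in J &, forall x y, x != y -> (2 * lam <= ndist x y)%N} ->
  (forall x, x \in J -> (lam <= x)%N /\ (x + lam <= n)%N) ->
  128 * (2 * (\sum_(a < n) starts lam J a)%:R + 16 * (size J)%:R * (1 + ln n%:R))
    <= M%:R :> R ->
  (forall i, sqnorm (mulAx A (tv_atom R lam J i)) <= 4 * m%:R) ->
  (forall t : M.-tuple ('I_n.-1.+1 * bool),
     m%:R / 6 * sqnorm (signed_sum (tv_atom R lam J) t)
     <= sqnorm (mulAx A (signed_sum (tv_atom R lam J) t))) ->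
  unique_tv_solution A (mulAx A xs) xs.
Proof.
(* Destructing [n] makes ['I_n.-1.+1] convertible to ['I_n], over which the block lemmas are
   stated. *)
case: n xs A => // n xs A J m0 n0 lam0 sepJ bndJ kM Aatom Alow; split=> // z Az zx.
rewrite ltNge; apply/negP => tvz; apply: zx.
pose h (i : nat) : R := z (inord i) - xs (inord i).
have hE (l : 'I_n.+1) : h l = z l - xs l by rewrite /h inord_val.
have descent : \sum_(1 <= i < n.+1 | i \notin J) `|h i - h i.-1|
    <= - \sum_(x <- J) jump_sign xs x * (h x - h x.-1).
  have gE i : h i - h i.-1 = grad z i - grad xs i by rewrite /h /grad; ring.
  rewrite (eq_bigr (fun i => `|grad z i - grad xs i|)); last by move=> i _; rewrite gE.
  rewrite [X in - X](eq_bigr (fun i => jump_sign xs i * (grad z i - grad xs i)));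
    last by move=> i _; rewrite gE.
  exact: tv_descent.
have bound := block_coef_bound lam0 (jump_set_uniq xs) sepJ bndJ
  (jump_sign_sqr xs) descent.
pose c (i : 'I_n.+1) := block_coef n.+1 (starts lam J) h i.
have expand : (fun l : 'I_n.+1 => \sum_i c i * tv_atom R (n := n.+1) lam J i l) = (fun l : 'I_n.+1 => z l - xs l).
  apply/funext => l; rewrite -hE; apply/esym.
  exact: (block_expansion (starts0 lam J) h (ltn_ord l)).
have := @kernel_trivial R m n.+1 n.+1 M A (tv_atom R (n := n.+1) lam J) c _ m0
  (fun i => tv_atom_sqnorm (n := n.+1) R lam J i n0) Aatom Alow _ _ kM.
rewrite expand => K0.
have /eqP : sqnorm (fun l : 'I_n.+1 => z l - xs l) = 0.
  apply: K0.
    move=> j; have := congr1 (fun f => f j) Az; rewrite /mulAx /= => e.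
    by under eq_bigr do rewrite mulrBr; rewrite sumrB e subrr.
  have -> : sqnorm (fun l : 'I_n.+1 => z l - xs l) = \sum_(i < n.+1) h i ^+ 2.
    by apply: eq_bigr => l _; rewrite hE.
  exact: bound.
rewrite /sqnorm psumr_eq0 => [/allP z0|i _]; last exact: sqr_ge0.
apply/funext => l; have := z0 l; rewrite mem_index_enum => /(_ isT).
by rewrite sqrf_eq0 subr_eq0 => /eqP.
Qed.

(** The number of events is at most (2n)^(M+1), whose logarithm is at most 2 ln n * 128 * 109 q =
    27904 q ln n; a quarter of 450^2 is 50625, which also leaves room for u^2 / 2. *)
Lemma union_bound_exponent (R : realType) (n m M : nat) (q u : R) :
  (2 <= n)%N -> 1 / 2 <= q -> M%:R <= 128 * 108 * q + 1 ->
  450 * 450 * (q * ln n%:R + u ^+ 2) <= m%:R ->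
  ((n * 2) ^ M + n)%:R * expR (- (m%:R / 4)) <= expR (- (u ^+ 2) / 2).
Proof.
move=> n2 q2 Mq mC.
have n0 : (0 : R) < n%:R by rewrite ltr0n; lia.
have lnn : 1 / 2 <= ln (n%:R : R).
  by apply: le_trans (ln2_ge_half R) _; rewrite ler_ln ?posrE ?ltr0n ?ler_nat//; lia.
have ln2n : ln (n%:R : R) + ln 2 <= 2 * ln n%:R.
  have : ln 2 <= ln (n%:R : R) by rewrite ler_ln ?posrE ?ler_nat.
  lra.
apply: (@le_trans _ _ (((n * 2) ^ M.+1)%:R * expR (- (m%:R / 4)))).
  rewrite ler_pM2r ?expR_gt0// ler_nat expnS.
  have : (n <= (n * 2) ^ M * n)%N by rewrite leq_pmull// expn_gt0; lia.
  have : ((n * 2) ^ M <= (n * 2) ^ M * n)%N by rewrite leq_pmulr//; lia.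
  lia.
have -> : ((n * 2) ^ M.+1)%:R = expR ((ln n%:R + ln 2) * M.+1%:R) :> R.
  by rewrite [_ * M.+1%:R]mulrC expRM_natl exp.expRD !lnK ?posrE// natrX natrM.
rewrite -exp.expRD ler_expR.
have M1 : (M.+1%:R : R) <= 128 * 109 * q by rewrite -natr1; lra.
have : (ln n%:R + ln 2) * M.+1%:R <= 2 * ln n%:R * (128 * 109 * q).
  by apply: ler_pM => //; rewrite addr_ge0//; have := ln2_ge_half R; lra.
have : 0 <= u ^+ 2 := sqr_ge0 u.
have : 0 <= q * ln (n%:R : R) by rewrite mulr_ge0//; lra.
rewrite mulrDr in mC.
rewrite (_ : 2 * ln n%:R * (128 * 109 * q) = 2 * 128 * 109 * (q * ln n%:R)); last by ring.
lra.
Qed.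

Lemma ndist_ge (a b k : nat) : (a + k <= b)%N ->
  (k <= ndist a b)%N /\ (k <= ndist b a)%N.
Proof. by rewrite /ndist; lia. Qed.

Lemma tv_recovery (R : realType) (n : nat) (Delta u : R) (xs : 'I_n.-1.+1 -> R)
    (m : nat) (d : measure_display) (T : measurableType d) (P : probability T R)
    (A : 'I_m -> 'I_n.-1.+1 -> T -> R) :
  (2 <= n)%N -> delta_separated Delta xs -> (0 < size (jump_set xs))%N ->
  8 * (size (jump_set xs))%:R / n%:R <= Delta -> 0 < u ->
  iid_std_gaussian P A ->
  450 * 450 * (Delta^-1 * (size (jump_set xs))%:R * ln n%:R ^+ 2 + u ^+ 2) <= m%:R ->
  exists E : set T, measurable E /\
    E `<=` [set w | unique_tv_solution (fun j i => A j i w)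
                       (mulAx (fun j i => A j i w) xs) xs] /\
    ((1 - expR (- (u ^+ 2) / 2))%:E <= P E)%E.
Proof.
move=> n2 sepx s0 D8 u0 gA mC.
set J := jump_set xs in s0 D8 mC *; set s : R := (size J)%:R in D8 mC *.
have n0 : (0 < n)%N by exact: ltnW.
have nR : (0 : R) < n%:R by rewrite ltr0n.
have s1 : 1 <= s by rewrite ler1n.
have D0 : 0 < Delta by apply: lt_le_trans D8; rewrite divr_gt0// mulr_gt0//; lra.
pose gap := Delta * n%:R / (size J).+1%:R.
(* The assumption on Delta gives gap >= 8 s / (s + 1), and s >= 1. *)
have gap4 : 4 <= gap.
  rewrite ler_pdivlMr ?ltr0n// -natr1 -/s.
  by move: D8; rewrite ler_pdivrMr//; lra.
have gap0 : 0 <= gap by lra.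
have D1 : Delta <= 1.
  have := gap_total n0 sepx; rewrite mulrC divfK ?gt_eqF ?ltr0n//.
  by rewrite ger_pMl.
have [lam [lam0 lamgap gaplam]] := nat_half_approx gap4.
have near (a b : nat) : gap <= b%:R - a%:R -> (a + 2 * lam <= b)%N.
  by move=> g; rewrite -(ler_nat R) natrD natrM; lra.
have sepJ : {in J &, forall x y, x != y -> (2 * lam <= ndist x y)%N}.
  move=> x y xJ yJ; rewrite neq_ltn => /orP[xy|yx].
    by have [] := ndist_ge (near _ _ (gap_between n0 sepx gap0 xJ yJ xy)).
  by have [] := ndist_ge (near _ _ (gap_between n0 sepx gap0 yJ xJ yx)).
have bndJ x : x \in J -> (lam <= x)%N /\ (x + lam <= n)%N.
  have lam2 : (lam <= 2 * lam)%N by rewrite leq_pmull.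
  move=> xJ; split.
    apply: (leq_trans lam2); have := near 0%N x; rewrite add0n subr0; apply.
    exact: gap_left.
  by apply: leq_trans (near _ _ (gap_right n0 sepx gap0 xJ)); rewrite leq_add2l.
have Jn x : x \in J -> (x < n)%N.
  by move=> /bndJ [_]; apply: leq_trans; rewrite -addn1 leq_add2l.
pose kap : R := 2 * (\sum_(a < n) starts lam J a)%:R + 16 * s * (1 + ln n%:R).
pose q := Delta^-1 * s * ln n%:R.
have kapq : kap <= 108 * q by exact: starts_count_bound.
have lnn : 1 / 2 <= ln (n%:R : R).
  by apply: le_trans (ln2_ge_half R) _; rewrite ler_ln ?posrE ?ler_nat.
have kap0 : 0 <= 128 * kap.
  rewrite mulr_ge0// addr_ge0// !mulr_ge0//; lra.
have q2 : 1 / 2 <= q.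
  have D1' : 1 <= Delta^-1 by rewrite invf_ge1.
  have Ds1 : 1 <= Delta^-1 * s by exact: mulr_ege1.
  by apply: (le_trans lnn); rewrite ler_peMl//; lra.
pose M := (Num.truncn (128 * kap)).+1.
have /andP[M1 M2] := Num.Theory.truncn_itv kap0.
have kM : 128 * kap <= M%:R by exact: ltW.
have Mq : M%:R <= 128 * 108 * q + 1 by rewrite /M -natr1; lra.
have mC' : 450 * 450 * (q * ln n%:R + u ^+ 2) <= m%:R.
  by rewrite (_ : q * ln n%:R = Delta^-1 * s * ln n%:R ^+ 2)// /q expr2 mulrA.
have m0 : (0 < m)%N.
  have C0 : (0 : R) < 450 * 450 by apply: mulr_gt0; rewrite ltr0n.
  have Q0 : 0 < q * ln n%:R + u ^+ 2.
    by apply: addr_gt0; [apply: mulr_gt0; lra | exact: exprn_gt0].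
  by rewrite -(ltr0n R); exact: lt_le_trans (mulr_gt0 C0 Q0) mC'.
pose Aw w j i := A j i w.
pose atom := tv_atom R (n := n) lam J.
pose K : finType := (M.-tuple ('I_n.-1.+1 * bool) + 'I_n.-1.+1)%type.
pose bad (k : K) : set T := match k with
  | inl t => [set w | sqnorm (mulAx (Aw w) (signed_sum atom t))
                      < m%:R / 6 * sqnorm (signed_sum atom t)]
  | inr i => [set w | 4 * m%:R < sqnorm (mulAx (Aw w) (atom i))] end.
have mbad k : measurable (bad k).
  case: k => [t|i]; apply: measurable_set_lt; rewrite /Aw;
    by [exact: measurable_sqnorm_image gA _ | exact: measurable_cst].
have Pbad k : (P (bad k) <= (expR (- (m%:R / 4)))%:E)%E.
  case: k => [t|i]; first exact: sqnorm_image_lower_tail.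
  by apply: sqnorm_image_upper_tail => //; exact: tv_atom_sqnorm.
pose U := \big[setU/set0]_(k <- enum K) bad k.
have mU : measurable U by exact: bigsetU_measurable.
(* The complement of finitely many bad events is measurable and contained in the success set. *)
exists (~` U); split; first exact: measurableC.
split.
  move=> w wU.
  have good k : ~ bad k w.
    by move=> bk; apply: wU; rewrite /U (big_rem k) ?mem_enum//=; left.
  apply: (@tv_unique R m n M lam xs (Aw w) m0 n0 lam0 sepJ bndJ kM).
    by move=> i; rewrite leNgt; apply/negP; exact: (good (inr i)).
  by move=> t; rewrite leNgt; apply/negP; exact: (good (inl t)).
rewrite probability_setC// EFinB leeB//.
apply: (le_trans (union_bound _ mbad Pbad)); rewrite lee_fin.
rewrite -cardE card_sum card_tuple card_prod card_bool !card_ord prednK//.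
exact: union_bound_exponent mC'.
Qed.

Theorem theorem1 :
  exists C : Rdefinitions.R, 0 < C /\
  forall (n : nat) (Delta u : Rdefinitions.R) (xs : 'I_n.-1.+1 -> Rdefinitions.R)
         (m : nat) (d : measure_display) (T : measurableType d)
         (P : probability T Rdefinitions.R)
         (A : 'I_m -> 'I_n.-1.+1 -> T -> Rdefinitions.R),
    (2 <= n)%N ->
    delta_separated Delta xs ->
    (0 < size (jump_set xs))%N ->
    8 * (size (jump_set xs))%:R / n%:R <= Delta ->
    0 < u ->
    iid_std_gaussian P A ->
    C * (Delta^-1 * (size (jump_set xs))%:R * ln (n%:R) ^+ 2 + u ^+ 2) <= m%:R ->
    exists E : set T, measurable E /\
      E `<=` [set w | unique_tv_solution (fun j i => A j i w)
                         (mulAx (fun j i => A j i w) xs) xs] /\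
      ((1 - expR (- (u ^+ 2) / 2))%:E <= P E)%E.
Proof.
exists (450 * 450); split; first by apply: mulr_gt0; rewrite ltr0n.
by move=> n Delta u xs m d T P A; exact: tv_recovery.
Qed.
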